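(* Let $n \geq 13$ and let $G$ be a $2$-connected graph on $n$ vertices with minimum degree $\delta(G) \geq \frac{n-1}{3}$. Then $G$ contains a spanning jellyfish.
   Context: Graphs are finite and simple. A jellyfish is a graph consisting of a cycle $C$ together with a (possibly empty) set $X$ of vertices outside $C$, each joined by an edge to one and the same vertex of $C$. A spanning jellyfish in $G$ is a (not necessarily induced) subgraph of $G$ that is a jellyfish and contains all vertices of $G$; equivalently, $G$ has a cycle $C$ and a vertex $v\in V(C)$ such that every vertex of $V(G)\setminus V(C)$ is adjacent to $v$. *)

(* Defs.v *)
From mathcomp Require Import all_boot.

Set Implicit Arguments.
Unset Strict Implicit.
Unset Printing Implicit Defensive.

Definition simple_graph (T : finType) (e : rel T) : Prop :=
  symmetric e /\ irreflexive e.

Definition degree (T : finType) (e : rel T) (x : T) : nat := #|e x|.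

(* On a nonempty simple graph every degree is smaller than #|T|, so the
   default value #|T| never wins the minimum. *)
Definition min_degree (T : finType) (e : rel T) : nat :=
  \big[minn/#|T|]_(x : T) degree e x.

(* Any two vertices of A are joined by a path all of whose vertices lie in A,
   i.e. the subgraph induced by A is connected (or empty). *)
Definition connected_on (T : finType) (e : rel T) (A : {set T}) : Prop :=
  {in A &, forall x y, connect [rel u v in A | e u v] x y}.

Definition k_connected (k : nat) (T : finType) (e : rel T) : Prop :=
  k < #|T| /\ forall S : {set T}, #|S| < k -> connected_on e (~: S).

(* c lists the vertices of a cycle in cyclic order; next c x is the successor
   of x in c, but next c x = x when x \notin c, hence the membership tests. *)
Definition cycle_edge (T : finType) (c : seq T) : rel T :=
  [rel x y | (x \in c) && (y == next c x) || (y \in c) && (x == next c y)].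

Definition pendant_edge (T : finType) (c : seq T) (v : T) : rel T :=
  [rel x y | (x == v) && (y \notin c) || (y == v) && (x \notin c)].

(* The graph (T, f) consists exactly of a cycle together with all the other
   vertices, each of them joined to the vertex v of the cycle and to no other
   vertex. *)
Definition jellyfish (T : finType) (f : rel T) : Prop :=
  exists (c : seq T) (v : T),
    [/\ 3 <= size c, uniq c, v \in c &
        forall x y, f x y = cycle_edge c x y || pendant_edge c v x y].

(* A subgraph of (T, e) that contains all the vertices is given by a
   subrelation of e on the same vertex type T. *)
Definition has_spanning_jellyfish (T : finType) (e : rel T) : Prop :=
  exists2 f : rel T, subrel f e & jellyfish f.

(* Main.v *)
Require Import Defs.
From mathcomp Require Import all_boot all_order all_algebra.
From mathcomp Require Import zify.

(** Let [C] be a longest cycle, of length [L], and write [d] for the minimum degree,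
so that [n <= 3 d + 1].

If the complement of every longest cycle is independent, suppose that there is no
spanning jellyfish.  When at least three vertices lie outside [C], no two
consecutive vertices of [C] both have neighbours outside.  An outside vertex
adjacent to both cycle-neighbours of a vertex [z] can replace [z] in [C]; call
such [z] slots, and let [Y] be the set of neighbours of outside vertices and of
slots.  No two vertices of [Y] are consecutive on [C], so [2 |Y| <= L].  For each
vertex [u] of [C] the outside vertices not adjacent to [u] cannot all be exchanged
against neighbours of [u], so, by Hall-type greedy choice, some outside [y] has few
slots adjacent to [u].  Counting nonadjacent pairs between [Y] and the slots then
contradicts [n <= 3 d + 1].

Otherwise some longest cycle [C] leaves a component [K] with [m >= 2] vertices; let
[S] be its set of [sg] attachments on [C].  A degree sum argument for the successors
of two attachments gives [m + sg <= d + 3], so every vertex of [K] is adjacent to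
all but at most [m + sg - 1 - d <= 2] of the other vertices of [K] and [S].
Hence any two attachments are joined by paths through nearly all of [K], the gaps
between consecutive attachments are long, and [L] would be too large unless
[m + sg = d + 1], or only the two vertices of [K] lie outside [C] and have a common
neighbour.  In the first case [K] is a clique completely joined to [S], at most
two further vertices lie outside [C], and they have a common neighbour in [S]. *)

Set Implicit Arguments.
Unset Strict Implicit.
Unset Printing Implicit Defensive.

(** * Walks and surgery on a longest cycle *)

(** Only numeric hypotheses are kept for [lia]; the combinatorial contexts below would slow it
    down. *)
Ltac arith :=
  repeat match goal with H : ?P |- _ =>
    lazymatch P with
    | is_true (leq _ _) => fail
    | is_true (andb (leq _ _) (leq _ _)) => fail
    | is_true (negb (leq _ _)) => fail
    | @eq nat _ _ => fail
    | @eq bool (leq _ _) _ => fail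
    | nat => fail
    | _ => clear H
    end
  end; lia.

Section Walks.

Variables (T : eqType) (e : rel T).
Hypothesis e_sym : symmetric e.

Definition walk (s : seq T) (x y : T) : bool :=
  if s is z :: s' then [&& z == x, path e z s' & last z s' == y] else false.

(* [k] lists only the inner vertices, so that [link [::] x y] is the edge [x y]. *)
Definition link (k : seq T) (x y : T) : bool := path e x (rcons k y).

Lemma link0 x y : link [::] x y = e x y.
Proof. by rewrite /link /= andbT. Qed.

Lemma link1 z x y : link [:: z] x y = e x z && e z y.
Proof. by rewrite /link /= andbT. Qed.

Lemma link_rev k x y : link k x y -> link (rev k) y x.
Proof.
rewrite /link -rev_cons => kxy.
have := rev_path e x (rcons k y); rewrite last_rcons belast_rcons => ->.
by rewrite (eq_path (e' := e)) // => u v; rewrite e_sym.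
Qed.

Lemma walk_link s k t x y x' y' :
  walk s x y -> link k y x' -> walk t x' y' -> walk (s ++ k ++ t) x y'.
Proof.
case: s => //= z s /and3P[-> zs /eqP<-]; rewrite /link rcons_path => /andP[ks kx'].
case: t => //= w t /and3P[/eqP-> wt /eqP<-] /=.
by rewrite !cat_path /= zs ks kx' !last_cat /= wt !eqxx.
Qed.

Lemma walk_edge s t x y x' y' :
  walk s x y -> e y x' -> walk t x' y' -> walk (s ++ t) x y'.
Proof. by move=> s_w yx'; apply: (walk_link s_w (k := [::])); rewrite link0. Qed.

Lemma walk_rev s x y : walk s x y -> walk (rev s) y x.
Proof.
case: s => // z s /= /and3P[/eqP<- zs /eqP<-].
have := rev_path e z s; rewrite (eq_path (e' := e)); last by move=> u v; rewrite e_sym.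
move=> zsr; rewrite lastI rev_rcons /= eqxx zsr zs /=.
by case: s {zs zsr} => //= w s; rewrite rev_cons last_rcons.
Qed.

Lemma walk_cycle s k x y : walk s x y -> link k y x -> cycle e (s ++ k).
Proof.
case: s => // z s /= /and3P[/eqP<- zs /eqP<-]; rewrite /link => kz.
by rewrite rcons_cat cat_path zs.
Qed.

Definition seg (c : seq T) i j := drop i (take j c).

Lemma size_seg c i j : j <= size c -> size (seg c i j) = j - i.
Proof. by move=> jc; rewrite size_drop size_takel. Qed.

(** Additivity over adjacent segments turns disjointness of the pieces of a new cycle into linear
    arithmetic on multiplicities; [uniq_count] then recovers [uniq]. *)
Lemma count_segD p c j i k : i <= j <= k ->
  count p (seg c i k) = count p (seg c i j) + count p (seg c j k).
Proof.
move=> /andP[ij jk].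
have segE a b : a <= b -> seg c a b = take (b - a) (drop a c).
  by move=> ab; rewrite take_drop subnK.
rewrite !segE //; last exact: leq_trans jk.
have -> : k - i = (j - i) + (k - j) by arith.
by rewrite takeD count_cat drop_drop subnK.
Qed.

Lemma count_seg_full p c : count p c = count p (seg c 0 (size c)).
Proof. by rewrite /seg drop0 take_size. Qed.

Lemma walk_seg x0 c i j : cycle e c -> i < j <= size c ->
  walk (seg c i j) (nth x0 c i) (nth x0 c j.-1).
Proof.
move=> ce /andP[ij jc].
have ci : i < size c by arith.
have sc : sorted e c.
  by case: c {ij jc ci} ce => //= x p; rewrite rcons_path => /andP[].
have : sorted e (seg c i j) by apply: drop_sorted; apply: take_sorted.
have -> : nth x0 c i = nth x0 (seg c i j) 0 by rewrite nth_drop nth_take // addn0.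
have -> : nth x0 c j.-1 = last x0 (seg c i j).
  by rewrite -nth_last size_seg // nth_drop nth_take; first congr nth; arith.
have := size_seg i jc.
by case: (seg c i j) => [|z s] /=; [arith | move=> _ ->; rewrite !eqxx].
Qed.

Lemma cycle_nth_last x0 c : cycle e c -> 0 < size c ->
  e (nth x0 c (size c).-1) (nth x0 c 0).
Proof.
by case: c => //= x p; rewrite rcons_path => /andP[_ px _]; rewrite (last_nth x0) in px.
Qed.

Lemma uniq_count (s : seq T) : (forall z, count_mem z s <= 1) -> uniq s.
Proof.
move=> s1; apply: count_mem_uniq => z; have := s1 z; rewrite -has_pred1 has_count.
by case: (count_mem z s) => [|[]].
Qed.

End Walks.

(** * Longer cycles obtained by rerouting a longest cycle *)

Section Surgery.

Variables (T : eqType) (e : rel T) (L : nat) (x0 : T).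
Hypothesis e_sym : symmetric e.
Hypothesis L_max : forall s, uniq s -> cycle e s -> size s <= L.

Definition lcycle (c : seq T) := [&& uniq c, cycle e c & size c == L].

Lemma close_walk s k x y : (forall z, count_mem z s + count_mem z k <= 1) ->
  walk e s x y -> link e k y x -> size s + size k <= L.
Proof.
move=> sk sw kl; rewrite -size_cat; apply: L_max; last exact: walk_cycle sw kl.
by apply: uniq_count => z; rewrite count_cat.
Qed.

Variable c : seq T.
Hypothesis c_long : lcycle c.

Local Notation "s .[ i ]" := (nth x0 s i).
Local Notation segc := (seg c).

Let c_uniq : uniq c. Proof. by case/and3P: c_long. Qed.
Let c_cycle : cycle e c. Proof. by case/and3P: c_long. Qed.
Let c_size : size c = L. Proof. by case/and3P: c_long => _ _ /eqP. Qed.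

(** One bound on multiplicities says both that [k] has no repetitions and that it avoids [c]. *)
Definition disj (k : seq T) := forall z, count_mem z c + count_mem z k <= 1.

Lemma disj1 y : y \notin c -> disj [:: y].
Proof.
move=> yc z /=; rewrite (count_uniq_mem z c_uniq) addn0.
by case: (eqVneq y z) => [<-|_]; rewrite ?(negPf yc) ?addn0 ?leq_b1.
Qed.

Let wseg i j : i < j <= L -> walk e (segc i j) c.[i] c.[j.-1].
Proof. by move=> ij; apply: walk_seg; rewrite ?c_size. Qed.

Let cseg z : count_mem z c = count_mem z (segc 0 L).
Proof. by rewrite count_seg_full c_size. Qed.

Let sseg i j : j <= L -> size (segc i j) = j - i.
Proof. by move=> jL; rewrite size_seg ?c_size. Qed.

(* In each of the following lemmas a cycle longer than [c] would be obtained by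
   cutting [c] into segments and joining them through vertices outside [c]. *)
Lemma shortcut k i : disj k -> i < L ->
  link e k c.[L.-1] c.[i] -> size k <= i.
Proof.
move=> kc iL kl.
have w1 : walk e (segc i L) c.[i] c.[L.-1] by apply: wseg; arith.
have := close_walk _ w1 kl; rewrite sseg //.
suff cnt z : count_mem z (segc i L) + count_mem z k <= 1 by move=> /(_ cnt); arith.
have := kc z; rewrite cseg (count_segD _ _ (j := i)) ?leq0n ?(ltnW iL) //; arith.
Qed.

(** The new cycle runs from [c.[0]] to [c.[j]], through [k] to [c.[i]], backwards to [c.[l]], and
    through [k'] home. *)
Lemma cross k k' j l i : (forall z, count_mem z c + count_mem z k + count_mem z k' <= 1) ->
  j < l <= i -> i < L ->
  link e k c.[j] c.[i] -> link e k' c.[l] c.[0] ->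
  j.+1 + size k + (i.+1 - l) + size k' <= L.
Proof.
move=> kc /andP[jl li] iL kl kl'.
have w1 : walk e (segc 0 j.+1) c.[0] c.[j] by apply: wseg; arith.
have w2 : walk e (rev (segc l i.+1)) c.[i] c.[l].
  by apply: walk_rev => //; apply: (@wseg l i.+1); arith.
have := close_walk _ (walk_link w1 kl w2) kl'.
rewrite !size_cat size_rev !sseg; try arith.
suff cnt z : count_mem z (segc 0 j.+1 ++ k ++ rev (segc l i.+1)) + count_mem z k' <= 1.
  by move=> /(_ cnt); arith.
rewrite !count_cat count_rev; have := kc z; rewrite cseg.
rewrite (count_segD _ _ (j := j.+1) (k := L)); last arith.
rewrite (count_segD _ _ (j := l) (k := L)); last arith.
rewrite (count_segD _ _ (j := i.+1) (k := L)); arith.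
Qed.

(** The new cycle runs from [c.[j]] to [c.[l]], through [k'] to [c.[0]], along the cycle edge to
    [c.[L.-1]], backwards to [c.[i]], and through [k] home. *)
Lemma cross_back k k' j l i :
  (forall z, count_mem z c + count_mem z k + count_mem z k' <= 1) ->
  0 < j <= l -> l < i < L ->
  link e k' c.[l] c.[0] -> link e k c.[i] c.[j] ->
  (l.+1 - j) + size k' + 1 + (L - i) + size k <= L.
Proof.
move=> kc /andP[j0 jl] /andP[li iL] kl' kl.
have w1 : walk e (segc j l.+1) c.[j] c.[l] by apply: wseg; arith.
have w2 : walk e (segc 0 1) c.[0] c.[0] by apply: wseg; arith.
have w3 : walk e (rev (segc i L)) c.[L.-1] c.[i].
  by apply: walk_rev => //; apply: wseg; arith.
have e0 : e c.[0] c.[L.-1].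
  by rewrite e_sym -c_size; apply: cycle_nth_last => //; arith.
have := close_walk _ (walk_link w1 kl' (walk_edge w2 e0 w3)) kl.
rewrite !size_cat size_rev !sseg; try arith.
suff cnt z : count_mem z (segc j l.+1 ++ k' ++ segc 0 1 ++ rev (segc i L))
             + count_mem z k <= 1 by move=> /(_ cnt); arith.
rewrite !count_cat count_rev; have := kc z; rewrite cseg.
rewrite (count_segD _ _ (j := 1) (k := L)); last arith.
rewrite (count_segD _ _ (j := j) (k := L)); last arith.
rewrite (count_segD _ _ (j := l.+1) (k := L)); last arith.
rewrite (count_segD _ _ (j := i) (k := L)); arith.
Qed.

(** The new cycle runs from [c.[0]] to [c.[i]], jumps to [c.[b.+1]], goes on to [c.[L.-1]], through
    [k] to [c.[b]] and backwards to [c.[i']]; only the vertices strictly between [i] and [i'] are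
    lost. *)
Lemma cross_detour k i i' b : disj k -> i < i' <= b -> b.+1 < L ->
  link e k c.[L.-1] c.[b] -> e c.[i] c.[b.+1] -> e c.[i'] c.[0] ->
  size k + i.+1 <= i'.
Proof.
move=> kc /andP[ii' i'b] bL kl eib ei'0.
have w1 : walk e (segc 0 i.+1) c.[0] c.[i] by apply: wseg; arith.
have w2 : walk e (segc b.+1 L) c.[b.+1] c.[L.-1] by apply: wseg; arith.
have w3 : walk e (rev (segc i' b.+1)) c.[b] c.[i'].
  by apply: walk_rev => //; apply: (@wseg i' b.+1); arith.
have := close_walk _ (walk_edge w1 eib (walk_link w2 kl w3)) (k := [::]).
rewrite link0 ei'0 !size_cat size_rev !sseg /=; try arith.
suff cnt z : count_mem z (segc 0 i.+1 ++ segc b.+1 L ++ k ++ rev (segc i' b.+1)) + 0 <= 1.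
  by move=> /(_ cnt isT); arith.
rewrite !count_cat count_rev; have := kc z; rewrite cseg.
rewrite (count_segD _ _ (j := i.+1) (k := L)); last arith.
rewrite (count_segD _ _ (j := i') (k := L)); last arith.
rewrite (count_segD _ _ (j := b.+1) (k := L)); arith.
Qed.

Lemma cross_pair x y i i' : x != y -> x \notin c -> y \notin c -> i < i' < L ->
  e x c.[0] -> e y c.[L.-1] -> e y c.[i] -> e x c.[i'] -> i.+2 < i'.
Proof.
move=> xy xc yc /andP[ii' i'L] ex0 eyL eyi exi'.
have w1 : walk e (segc 0 i.+1) c.[0] c.[i] by apply: wseg; arith.
have w3 : walk e (rev (segc i' L)) c.[L.-1] c.[i'].
  by apply: walk_rev => //; apply: wseg; arith.
have yl : link e [:: y] c.[i] c.[L.-1] by rewrite link1 (e_sym _ y) eyi.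
have xl : link e [:: x] c.[i'] c.[0] by rewrite link1 (e_sym _ x) exi'.
have := close_walk _ (walk_link w1 yl w3) xl.
rewrite !size_cat size_rev !sseg /=; try arith.
suff cnt z : count_mem z (segc 0 i.+1 ++ y :: rev (segc i' L)) + ((x == z) + 0) <= 1.
  by move=> /(_ cnt); arith.
rewrite count_cat /= count_rev.
have := disj1 xc z; have := disj1 yc z; rewrite /= cseg.
rewrite (count_segD _ _ (j := i.+1) (k := L)); last arith.
rewrite (count_segD _ _ (j := i') (k := L)); last arith.
by case: (eqVneq x z) => [<-|_]; rewrite 1?eq_sym ?(negPf xy); arith.
Qed.

(** The arcs from [0] to [i.-1], from [j.+1] to [L.-1] and from [i] to [j], with [y] between the
    first two, would form a cycle of length [L + 1]. The other [hop] lemmas likewise insert [y] and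
    lose no vertex. *)
Lemma hop_lt y i j : y \notin c -> 0 < i < j -> j.+1 < L ->
  e c.[i.-1] y -> e y c.[j.+1] -> e c.[L.-1] c.[i] -> ~~ e c.[j] c.[0].
Proof.
move=> yc /andP[i0 ij] jL eiy eyj eLi; apply/negP => ej0.
have w1 : walk e (segc 0 i) c.[0] c.[i.-1] by apply: wseg; arith.
have w2 : walk e (segc j.+1 L) c.[j.+1] c.[L.-1] by apply: wseg; arith.
have w3 : walk e (segc i j.+1) c.[i] c.[j] by apply: (@wseg i j.+1); arith.
have yl : link e [:: y] c.[i.-1] c.[j.+1] by rewrite link1 eiy.
have := close_walk _ (walk_link w1 yl (walk_edge w2 eLi w3)) (k := [::]).
rewrite link0 ej0 !size_cat !sseg /=; try arith.
suff cnt z : count_mem z (segc 0 i ++ y :: segc j.+1 L ++ segc i j.+1) + 0 <= 1.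
  by move=> /(_ cnt isT); arith.
rewrite count_cat /= count_cat; have := disj1 yc z; rewrite /= cseg.
rewrite (count_segD _ _ (j := i) (k := L)); last arith.
rewrite (count_segD _ _ (j := j.+1) (k := L)); arith.
Qed.

Lemma hop_gt y i j : y \notin c -> 0 < j < i -> i.+1 < L ->
  e c.[j.-1] y -> e y c.[i.+1] -> e c.[L.-1] c.[i] -> ~~ e c.[j] c.[0].
Proof.
move=> yc /andP[i0 ij] jL eiy eyj eLi; apply/negP => ej0.
have w1 : walk e (segc 0 j) c.[0] c.[j.-1] by apply: wseg; arith.
have w2 : walk e (segc i.+1 L) c.[i.+1] c.[L.-1] by apply: wseg; arith.
have w3 : walk e (rev (segc j i.+1)) c.[i] c.[j].
  by apply: walk_rev => //; apply: (@wseg j i.+1); arith.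
have yl : link e [:: y] c.[j.-1] c.[i.+1] by rewrite link1 eiy.
have := close_walk _ (walk_link w1 yl (walk_edge w2 eLi w3)) (k := [::]).
rewrite link0 ej0 !size_cat size_rev !sseg /=; try arith.
suff cnt z : count_mem z (segc 0 j ++ y :: segc i.+1 L ++ rev (segc j i.+1)) + 0 <= 1.
  by move=> /(_ cnt isT); arith.
rewrite count_cat /= count_cat count_rev; have := disj1 yc z; rewrite /= cseg.
rewrite (count_segD _ _ (j := j) (k := L)); last arith.
rewrite (count_segD _ _ (j := i.+1) (k := L)); arith.
Qed.

Lemma hop_first y i : y \notin c -> i.+1 < L ->
  e c.[0] y -> e y c.[i.+1] -> ~~ e c.[L.-1] c.[i].
Proof.
move=> yc iL e0y eyi; apply/negP => eLi.
have w1 : walk e (rev (segc 0 i.+1)) c.[i] c.[0].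
  by apply: walk_rev => //; apply: (@wseg 0 i.+1); arith.
have w2 : walk e (segc i.+1 L) c.[i.+1] c.[L.-1] by apply: wseg; arith.
have yl : link e [:: y] c.[0] c.[i.+1] by rewrite link1 e0y.
have := close_walk _ (walk_link w1 yl w2) (k := [::]).
rewrite link0 eLi !size_cat size_rev !sseg /=; try arith.
suff cnt z : count_mem z (rev (segc 0 i.+1) ++ y :: segc i.+1 L) + 0 <= 1.
  by move=> /(_ cnt isT); arith.
rewrite count_cat /= count_rev; have := disj1 yc z; rewrite /= cseg.
rewrite (count_segD _ _ (j := i.+1) (k := L)); arith.
Qed.

Lemma hop_last y j : y \notin c -> 0 < j < L ->
  e c.[j.-1] y -> e y c.[L.-1] -> ~~ e c.[j] c.[0].
Proof.
move=> yc /andP[j0 jL] ejy eyL; apply/negP => ej0.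
have w1 : walk e (segc 0 j) c.[0] c.[j.-1] by apply: wseg; arith.
have w2 : walk e (rev (segc j L)) c.[L.-1] c.[j].
  by apply: walk_rev => //; apply: wseg; arith.
have yl : link e [:: y] c.[j.-1] c.[L.-1] by rewrite link1 ejy.
have := close_walk _ (walk_link w1 yl w2) (k := [::]).
rewrite link0 ej0 !size_cat size_rev !sseg /=; try arith.
suff cnt z : count_mem z (segc 0 j ++ y :: rev (segc j L)) + 0 <= 1.
  by move=> /(_ cnt isT); arith.
rewrite count_cat /= count_rev; have := disj1 yc z; rewrite /= cseg.
rewrite (count_segD _ _ (j := j) (k := L)); arith.
Qed.

End Surgery.

(** * Cycles, degrees and connectivity *)

Lemma jellyfish_of_cycle (T : finType) (e : rel T) (c : seq T) (v : T) :
  symmetric e -> uniq c -> cycle e c -> 3 <= size c -> v \in c ->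
  (forall x, x \notin c -> e v x) -> has_spanning_jellyfish e.
Proof.
move=> e_sym uc ec c3 vc out.
exists (fun x y => cycle_edge c x y || pendant_edge c v x y); last by exists c, v.
move=> x y /orP[/orP[]|/orP[]] /andP[].
- by move=> xc /eqP->; apply: next_cycle.
- by move=> yc /eqP->; rewrite e_sym; apply: next_cycle.
- by move=> /eqP-> /out.
- by move=> /eqP-> /out; rewrite e_sym.
Qed.

Lemma min_degree_le (T : finType) (e : rel T) x : min_degree e <= degree e x.
Proof.
rewrite /min_degree.
have : x \in index_enum T by rewrite mem_index_enum.
elim: (index_enum T) => //= y s IH; rewrite big_cons inE => /orP[/eqP->|/IH IHs].
  exact: geq_minl.
exact: leq_trans (geq_minr _ _) IHs.
Qed.

Lemma rat_degree_bound (n d : nat) :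
  ((n%:R - 1) / 3%:R <= d%:R :> rat)%R -> n <= 3 * d + 1.
Proof.
rewrite Num.Theory.ler_pdivrMr ?Num.Theory.ltr0n // Num.Theory.lerBlDr.
by rewrite -GRing.natrM -[1%R]/(1%:R)%R -GRing.natrD Num.Theory.ler_nat mulnC.
Qed.

(** Otherwise [A] would be closed under adjacency outside [S], and no path avoiding [S] could lead
    from [x] to [y]. *)
Lemma exit_edge (T : finType) (e : rel T) (S A : {set T}) x y :
  symmetric e -> connected_on e (~: S) -> [disjoint A & S] ->
  x \in A -> y \notin A -> y \notin S ->
  exists u v, [/\ u \in A, v \notin A, v \notin S & e u v].
Proof.
move=> e_sym conn AS xA yA yS.
have [/existsP[u /existsP[v /and4P[uA vA vS euv]]]|none] :=
  boolP [exists u, exists v, [&& u \in A, v \notin A, v \notin S & e u v]].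
  by exists u, v.
pose r := [rel u v in ~: S | e u v].
have xS : x \notin S by apply: contraTN AS => xS; apply/pred0Pn; exists x; rewrite /= xA.
have cxy : connect r x y by apply: conn; rewrite inE.
have step u v : e u v -> u \in A -> v \notin S -> v \in A.
  move=> euv uA vS; apply: contraNT none => vA.
  by apply/existsP; exists u; apply/existsP; exists v; rewrite uA vA vS.
have clA : closed r A.
  move=> u v /= /andP[/andP[]]; rewrite !inE => uS vS euv.
  have evu : e v u by rewrite e_sym.
  by apply/idP/idP => h; [apply: step euv h vS | apply: step evu h uS].
by move: yA; rewrite -(closed_connect clA cxy) xA.
Qed.

Section Longest.

Variables (T : finType) (e : rel T).
Hypothesis e_sym : symmetric e.

Lemma exists_longest_cycle c0 : uniq c0 -> cycle e c0 ->
  exists c, [/\ uniq c, cycle e c, size c0 <= size c &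
    forall s, uniq s -> cycle e s -> size s <= size c].
Proof.
move=> u0 e0.
(* Tuples of fixed length make the existence of such a cycle decidable, as [ex_maxnP] requires. *)
pose P k := [exists t : k.-tuple T, uniq t && cycle e t].
have exP : exists k, P k.
  by exists (size c0); apply/existsP; exists (in_tuple c0); rewrite /= u0.
have ubP k : P k -> k <= #|T|.
  by move=> /existsP[t /andP[ut _]]; rewrite -(size_tuple t) -(card_uniqP ut) max_card.
have Pof s : uniq s -> cycle e s -> P (size s).
  by move=> us es; apply/existsP; exists (in_tuple s); rewrite /= us.
case: (ex_maxnP exP ubP) => k /existsP[t /andP[ut et]] kmax.
exists t; split=> //; first by rewrite size_tuple kmax ?Pof.
by move=> s us es; rewrite size_tuple kmax ?Pof.
Qed.

(** A path from [y] to [z] that avoids [x] is closed up through [x]. *)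
Lemma exists_cycle x y z : y != z -> e x y -> e x z -> x != y -> x != z ->
  connected_on e (~: [set x]) ->
  exists c, [/\ uniq c, cycle e c & 3 <= size c].
Proof.
move=> yz exy exz xy xz conn.
have : connect [rel u v in ~: [set x] | e u v] y z by apply: conn; rewrite !inE eq_sym.
case/connectP => p.
case/shortenP=> p' p'path up' _ zp.
have xp : x \notin y :: p'.
  rewrite inE negb_or xy /=; apply/negP => xp'.
  elim: p' y {exy xy yz conn up' zp} p'path xp' => //= u p' IH y.
  rewrite !inE => /andP[/andP[/andP[_ ux] _] pp] /orP[/eqP xu|xp']; last exact: IH pp xp'.
  by rewrite xu eqxx in ux.
exists [:: x, y & p']; split; first by rewrite cons_uniq xp.
- rewrite /= exy rcons_path -zp e_sym exz andbT.
  by apply: sub_path p'path => u v /= /andP[].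
- by case: p' zp {p'path up' xp} => //= zy; rewrite zy eqxx in yz.
Qed.

Variables (L : nat) (x0 : T).
Local Notation lcyc := (lcycle e L).
Local Notation "s .[ i ]" := (nth x0 s i).

Lemma next_nth_lt (c : seq T) i : uniq c -> i.+1 < size c -> next c c.[i] = c.[i.+1].
Proof.
move=> uc ic; rewrite next_nth mem_nth ?(ltnW ic) //.
case: c uc ic => // x p uc ip.
rewrite index_uniq //; last exact: ltnW.
by rewrite /=; apply: set_nth_default; rewrite /= in ip; lia.
Qed.

Lemma next_nth_last (c : seq T) : uniq c -> 0 < size c -> next c c.[(size c).-1] = c.[0].
Proof.
move=> uc c0; rewrite next_nth mem_nth; last by rewrite prednK.
case: c uc c0 => // x p uc _.
by rewrite index_uniq //= nth_default.
Qed.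

(** The surgery lemmas speak of positions [0] and [L.-1]; rotating brings any vertex there and keeps
    membership and successors. *)
Lemma rotate_first c x : lcyc c -> x \in c ->
  exists c', [/\ lcyc c', c' =i c, next c' =1 next c & c'.[0] = x].
Proof.
move=> /and3P[uc ec /eqP sc] xc; case: (rot_to xc) => n s rs.
exists (rot n c); split.
- by rewrite /lcycle rot_uniq uc rot_cycle ec size_rot sc /=.
- by move=> z; rewrite mem_rot.
- exact: next_rot.
- by rewrite rs.
Qed.

Lemma rotate_last c x : lcyc c -> x \in c ->
  exists c', [/\ lcyc c', c' =i c, next c' =1 next c & c'.[L.-1] = x].
Proof.
move=> lc xc; have [uc ec sc] := and3P lc.
have nxc : next c x \in c by rewrite mem_next.
case: (rotate_first lc nxc) => c' [lc' c'c n'n h'].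
exists c'; split=> //; have [uc' ec' /eqP sc'] := and3P lc'.
have xc' : x \in c' by rewrite c'c.
have s0 : 0 < size c' by case: (c') xc'.
apply: (can_inj (prev_next uc')); rewrite -sc' next_nth_last //.
by rewrite h' n'n.
Qed.

End Longest.

(** * Successors on a longest cycle *)

Section LongestCycle.

Variables (T : finType) (e : rel T) (L : nat).
Hypothesis e_sym : symmetric e.
Hypothesis e_irr : irreflexive e.
Hypothesis L_max : forall s, uniq s -> cycle e s -> size s <= L.

Local Notation lcyc := (lcycle e L).

Lemma lcycle_uniq c : lcyc c -> uniq c.
Proof. by case/and3P. Qed.

Lemma lcycle_cycle c : lcyc c -> cycle e c.
Proof. by case/and3P. Qed.

Lemma lcycle_size c : lcyc c -> size c = L.
Proof. by case/and3P => _ _ /eqP. Qed.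

Lemma lcycle_next c x : lcyc c -> x \in c -> e x (next c x).
Proof. by move=> lc xc; apply: next_cycle => //; apply: lcycle_cycle. Qed.

Lemma lcycle_inj c : lcyc c -> injective (next c).
Proof. by move=> lc; apply: can_inj (prev_next (lcycle_uniq lc)). Qed.

Lemma disj_outside (c k : seq T) : uniq c -> uniq k -> {in k, forall z, z \notin c} -> disj c k.
Proof.
move=> uc uk kc z; rewrite !count_uniq_mem //.
by case: (boolP (z \in k)) => [/kc/negPf->|_]; rewrite ?addn0 ?leq_b1.
Qed.

Lemma no_link_next c k x : lcyc c -> x \in c -> uniq k -> {in k, forall z, z \notin c} ->
  0 < size k -> ~~ link e k x (next c x).
Proof.
move=> lc xc uk kc k0; apply/negP => kl.
have [c' [lc' c'c n'n c'x]] := rotate_last x lc xc.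
have L0 : 0 < L by rewrite -(lcycle_size lc); case: (c) xc.
have := next_nth_last x (lcycle_uniq lc'); rewrite (lcycle_size lc') c'x n'n => /(_ L0) nx.
have dk : disj c' k by apply: disj_outside => [|//|z /kc]; rewrite ?c'c // lcycle_uniq.
have := shortcut (x0 := x) L_max lc' dk L0.
by rewrite c'x -nx leqn0 => /(_ kl); rewrite -(subnKC k0).
Qed.

(** With [a] rotated to the last position, [next c a] is in position [0], and [cross] with
    [l = j.+1] and [i = L.-1] loses no vertex of the cycle while gaining those of [k] and [k']. *)
Lemma no_cross c k k' a b : lcyc c -> a \in c -> b \in c -> a != b ->
  uniq (k ++ k') -> {in k ++ k', forall z, z \notin c} -> 0 < size (k ++ k') ->
  link e k b a -> ~~ link e k' (next c b) (next c a).
Proof.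
move=> lc ac bc ab ukk kkc kk0 kl; apply/negP => kl'.
have [c' [lc' c'c n'n c'a]] := rotate_last a lc ac.
have L0 : 0 < L by rewrite -(lcycle_size lc); case: (c) ac.
have sc' := lcycle_size lc'; have uc' := lcycle_uniq lc'.
have bc' : b \in c' by rewrite c'c.
set j := index b c'.
have c'b : nth a c' j = b by rewrite nth_index.
have jL : j < L by rewrite -sc' index_mem.
have jL1 : j.+1 < L.
  have : j != L.-1 by apply: contraNneq ab => jl; rewrite -c'a -c'b jl.
  by arith.
have nb : next c b = nth a c' j.+1.
  by have := next_nth_lt a (i := j) uc'; rewrite sc' c'b n'n => ->.
have := next_nth_last a uc'; rewrite sc' c'a n'n => /(_ L0) na.
have dk z : count_mem z c' + count_mem z k + count_mem z k' <= 1.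
  have := disj_outside uc' ukk _ z; rewrite count_cat addnA; apply=> w /kkc.
  by rewrite c'c.
have := @cross _ _ _ a e_sym L_max c' lc' k k' j j.+1 L.-1 dk.
rewrite c'b c'a -nb -na => /(_ _ _ kl kl'); move: kk0; rewrite size_cat.
have -> : j < j.+1 <= L.-1 by arith.
have -> : L.-1 < L by arith.
by move=> kk0 /(_ isT isT); arith.
Qed.

Lemma next_nonadj c y x : lcyc c -> y \notin c -> x \in c -> e y x -> ~~ e y (next c x).
Proof.
move=> lc yc xc yx; have := @no_link_next c [:: y] x lc xc isT _ isT.
rewrite link1 e_sym yx; apply=> z; by rewrite inE => /eqP->.
Qed.

Lemma next_next_nonadj c y a b : lcyc c -> y \notin c -> a \in c -> b \in c -> a != b ->
  e y a -> e y b -> ~~ e (next c a) (next c b).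
Proof.
move=> lc yc ac bc ab ya yb; have := @no_cross c [:: y] [::] b a lc bc ac _ isT _ isT.
rewrite link0 link1 e_sym ya yb eq_sym; apply=> //.
by move=> z; rewrite inE => /eqP->.
Qed.

Lemma next_next_common c x y a b : lcyc c -> x \notin c -> y \notin c -> x != y ->
  a \in c -> b \in c -> a != b -> e x a -> e x b ->
  e y (next c a) -> ~~ e y (next c b).
Proof.
move=> lc xc yc xy ac bc ab xa xb ya.
have := @no_cross c [:: x] [:: y] b a lc bc ac.
rewrite !link1 /= e_sym xa xb (e_sym _ y) ya eq_sym andbT inE xy; apply=> //.
by move=> z; rewrite !inE => /orP[]/eqP->.
Qed.

Lemma count_nat_sum (x0 : T) (p : pred T) c :
  count p c = \sum_(0 <= i < size c) p (nth x0 c i).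
Proof.
elim: c => [|x c IH]; first by rewrite big_geq.
by rewrite /= big_nat_recl //= IH.
Qed.

Lemma card_nbr_count x c : uniq c -> {subset e x <= c} ->
  #|[set y | e x y]| = count (e x) c.
Proof.
move=> uc xc; rewrite -size_filter -(card_uniqP (filter_uniq _ uc)).
by apply: eq_card => y; rewrite !inE mem_filter andb_idr //; apply: xc.
Qed.

(** For [i < k] at most one of [Y i], [X i.+1] and [X i.+2] holds, so these contribute at most [k];
    [X 0], counted twice, and [Y k.+1] contribute the other 3. *)
Lemma window_sum (X Y : nat -> bool) k : X 0 -> ~~ X 1 -> ~~ X k.+1 -> Y k.+1 -> ~~ Y k ->
  (forall i, i < k -> ~~ (X i.+1 && X i.+2)) ->
  (forall i, i < k -> ~~ (Y i && X i.+1)) ->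
  (forall i, i < k -> ~~ (Y i && X i.+2)) ->
  2 * (\sum_(0 <= i < k.+2) X i) + \sum_(0 <= i < k.+2) Y i <= k.+3.
Proof.
move=> X0 X1 Xk Yk Yk0 XX YX YXX.
have : \sum_(0 <= i < k) (Y i + X i.+1 + X i.+2) <= k.
  have kE : k = \sum_(0 <= i < k) 1 by rewrite sum_nat_const_nat muln1 subn0.
  rewrite [leqRHS]kE big_nat [leqRHS]big_nat.
  apply: leq_sum => i /andP[_ ik]; have := XX i ik; have := YX i ik; have := YXX i ik.
  by case: (Y i); case: (X i.+1); case: (X i.+2).
rewrite !big_split /= => bnd.
have sY : \sum_(0 <= i < k.+2) Y i = \sum_(0 <= i < k) Y i + 1.
  by rewrite !big_nat_recr //= (negPf Yk0) Yk addn0.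
have sX1 : \sum_(0 <= i < k.+2) X i = 1 + \sum_(0 <= i < k) X i.+1.
  by rewrite big_nat_recr //= (negPf Xk) addn0 big_nat_recl //= X0.
have sX2 : \sum_(0 <= i < k.+2) X i = 1 + \sum_(0 <= i < k) X i.+2.
  by rewrite big_nat_recl //= big_nat_recl //= X0 (negPf X1).
by rewrite sY mul2n -addnn {1}sX1 sX2; arith.
Qed.

(** The new cycle is the image of [c] under the involution [f] that exchanges [y] and [zf y] for all
    [y] in [M]. The cycle-neighbours of [zf y] are adjacent to [y], so by the last hypothesis they
    are not replaced themselves. *)
Lemma swap_cycle c (M : {set T}) (zf : T -> T) : lcyc c ->
  {in M &, injective zf} -> {in M, forall y, y \notin c} ->
  {in M, forall y, [/\ zf y \in c, e y (prev c (zf y)) & e y (next c (zf y))]} ->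
  {in M &, forall y y', ~~ e y' (zf y)} ->
  exists c', [/\ lcyc c',
     forall v, (v \in c') = (v \in c) && (v \notin zf @: M) || (v \in M) &
     forall u, u \in c -> u \notin zf @: M -> next c u \notin zf @: M ->
       next c' u = next c u].
Proof.
move=> lc zinj Mc zc zO; have uc := lcycle_uniq lc.
pose f v := if v \in M then zf v else
            if [pick y in M | zf y == v] is Some y then y else v.
have fM y : y \in M -> f y = zf y by rewrite /f => ->.
have fz y : y \in M -> f (zf y) = y.
  move=> yM; have [zyc _ _] := zc y yM.
  rewrite /f ifN; last by apply: contraL zyc => /Mc.
  by case: pickP => [y' /andP[y'M /eqP/zinj->] //|/(_ y)]; rewrite yM eqxx.
have fid v : v \notin M -> v \notin zf @: M -> f v = v.
  move=> vM vz; rewrite /f (negPf vM); case: pickP => // y /andP[yM /eqP yv].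
  by rewrite -yv imset_f in vz.
have ff : involutive f.
  move=> v; case: (boolP (v \in M)) => [vM|vM]; first by rewrite (fM v) // fz.
  case: (boolP (v \in zf @: M)) => [/imsetP[y yM ->]|vz]; first by rewrite fz // fM.
  by rewrite !fid.
have finj := inv_inj ff.
exists [seq f v | v <- c]; split.
- rewrite /lcycle map_inj_uniq // uc size_map (lcycle_size lc) eqxx andbT /=.
  apply: cycle_from_next => [|x /mapP[w wc ->]]; first by rewrite map_inj_uniq.
  rewrite next_map //.
  have nwc : next c w \in c by rewrite mem_next.
  have cM v : v \in c -> v \notin M by move=> vc; apply: contraL vc => /Mc.
  have nz y v : y \in M -> e y v -> v \notin zf @: M.
    by move=> yM yv; apply: contraL yv => /imsetP[y' y'M ->]; apply: zO.
  case: (boolP (w \in zf @: M)) => [/imsetP[y yM wE]|wz].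
    rewrite {1}wE fz // fid ?cM ?(nz y) //; first by rewrite wE; case: (zc y yM).
    by rewrite wE; case: (zc y yM).
  rewrite (fid w) ?cM //.
  case: (boolP (next c w \in zf @: M)) => [/imsetP[y yM nwE]|nwz].
    rewrite nwE fz // e_sym; case: (zc y yM) => _.
    by rewrite -nwE prev_next.
  by rewrite fid ?cM //; apply: lcycle_next.
- move=> v; rewrite -{1}(ff v) mem_map //.
  case: (boolP (v \in M)) => [vM|vM]; first by rewrite fM // orbT; case: (zc v vM).
  case: (boolP (v \in zf @: M)) => [/imsetP[y yM ->]|vz] /=.
    by rewrite fz // andbF; apply/negbTE/Mc.
  by rewrite fid // andbT orbF.
- move=> u ucc uz nz.
  have cM v : v \in c -> v \notin M by move=> vc; apply: contraL vc => /Mc.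
  by rewrite -{1}(fid u) ?cM // next_map // fid ?cM ?mem_next.
Qed.

End LongestCycle.

(** * Longest cycles with independent complement *)

(** Greedy choice: deleting the first representative from the other sets costs each at most one
    element, and one set fewer remains to be served. *)
Lemma distinct_representatives (T : finType) (M : seq T) (F : T -> {set T}) :
  uniq M -> {in M, forall y, size M <= #|F y|} ->
  exists zf, {in M &, injective zf} /\ {in M, forall y, zf y \in F y}.
Proof.
elim: M F => [|y M IH] F /=; first by exists id.
move=> /andP[yM uM] big.
have /card_gt0P[z zF] : 0 < #|F y| by apply: leq_trans (big y _); rewrite ?mem_head.
have big' : {in M, forall y', size M <= #|F y' :\ z|}.
  move=> y' y'M; have := big y'; rewrite inE y'M orbT => /(_ isT).
  by rewrite (cardsD1 z); case: (z \in F y'); arith.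
have [zf [zinj zM]] := IH _ uM big'.
exists (fun x => if x == y then z else zf x); split=> [a b|a].
  rewrite !inE; case: (eqVneq a y) => [->|ay]; case: (eqVneq b y) => [->|_] //=.
  - by move=> _ /zM; rewrite !inE => /andP[zz _] zE; rewrite zE eqxx in zz.
  - by move=> /zM; rewrite !inE => /andP[zz _] _ zE; rewrite zE eqxx in zz.
  - exact: zinj.
by rewrite !inE; case: eqVneq => [->|_] //= /zM; rewrite !inE => /andP[].
Qed.

Lemma exchange_nonadj (T : finType) (e : rel T) (A B : {set T}) : symmetric e ->
  \sum_(u in A) #|[set z in B | ~~ e u z]| = \sum_(z in B) #|[set u in A | ~~ e z u]|.
Proof.
move=> e_sym.
under eq_bigr do rewrite -sum1dep_card big_mkcondr.
rewrite exchange_big; apply: eq_bigr => z zB.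
by rewrite -sum1dep_card [RHS]big_mkcondr; apply: eq_bigr => u _; rewrite e_sym.
Qed.

(** In the application [h] vertices lie outside, [o], [s] and [q] are the sizes of [attach], [hull]
    and [gaps1], and [q'] is the number of slots. With [o = d + t] and [s = d + r] one gets
    [3 * t + h <= q + 1] and [2 * r + h <= d + 1], which contradict the last inequality. *)
Lemma counting_bound d L h o q q' s : 2 < h -> L + h <= 3 * d + 1 -> d <= o -> o <= s ->
  2 * s <= L -> 3 * o <= L + q -> q' <= q ->
  s * q.+1 <= q' * (s - d) + h * (s - d) + s * (2 * (o - d)) -> False.
Proof.
move=> h2 Lh dO os sL oq qq.
have [t ot] : exists t, o = d + t by exists (o - d); lia.
have [r sr] : exists r, s = d + r by exists (s - d); lia.
subst o s.
have -> : d + r - d = r by lia.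
have -> : d + t - d = t by lia.
move=> H.
have H1 : (d + r) * q.+1 <= q * r + h * r + (d + r) * (2 * t) by nia.
have H2 : d * q + d + r <= h * r + 2 * d * t + 2 * r * t by nia.
have H3 : 3 * t + h <= q + 1 by lia.
have H4 : d * (3 * t + h) + r <= h * r + 2 * d * t + 2 * r * t by nia.
have H5 : 2 * r + h <= d + 1 by lia.
have : 2 * r * t + h * t <= d * t + t by nia.
have : 2 * (h * r) + h * h <= d * h + h by nia.
by nia.
Qed.

Section Dominating.

Variables (T : finType) (e : rel T) (L d : nat).
Hypothesis e_sym : symmetric e.
Hypothesis e_irr : irreflexive e.
Hypothesis L_max : forall s, uniq s -> cycle e s -> size s <= L.

Local Notation lcyc := (lcycle e L).

Hypothesis L_ge3 : 3 <= L.
Hypothesis d_ge2 : 2 <= d.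
Hypothesis deg_ge : forall x, d <= #|[set y | e x y]|.
Hypothesis card_le : #|T| <= 3 * d + 1.
Hypothesis outside_indep : forall c, lcyc c ->
  forall x y, x \notin c -> y \notin c -> ~~ e x y.
Hypothesis no_jelly : forall c, lcyc c -> forall v, v \in c ->
  exists2 x, x \notin c & ~~ e v x.

Local Notation N x := [set y | e x y].

Lemma card_outside (c : seq T) : lcyc c -> #|[set x | x \notin c]| + L = #|T|.
Proof.
move=> lc; rewrite -(lcycle_size lc) -(card_uniqP (lcycle_uniq lc)) addnC -(cardC (mem c)).
by congr (_ + _); apply: eq_card => x; rewrite !inE.
Qed.

Lemma card_in_cycle (c : seq T) (A : {set T}) : lcyc c -> {subset A <= c} -> #|A| <= L.
Proof.
move=> lc Ac; rewrite -(lcycle_size lc) -(card_uniqP (lcycle_uniq lc)).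
exact/subset_leq_card/subsetP.
Qed.

Lemma nbr_in c x y : lcyc c -> x \notin c -> e x y -> y \in c.
Proof. by move=> lc xc; apply: contraTT => yc; apply: outside_indep lc _ _ xc yc. Qed.

(* Otherwise [x], the cycle from [next c a] to [a], and [y] form a path on [L + 2]
   vertices.  As there is no cycle of length [L + 1] or [L + 2], among the
   conditions that [y] be adjacent to the [i]-th vertex of the path and [x] to the
   next one or to the next but one, at most one holds; summing over [i] gives
   [3 * d <= L + 1]. *)
Lemma no_bad_pair c a x y : L + 3 <= #|T| -> lcyc c -> a \in c -> x \notin c ->
  y \notin c -> x != y -> e y a -> ~~ e x (next c a).
Proof.
move=> h3 lc ac xc yc xy ya; apply/negP => xa.
have [c' [lc' c'c n'n c'a]] := rotate_last a lc ac.
have uc' := lcycle_uniq lc'; have sc' := lcycle_size lc'.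
have := next_nth_last a uc'; rewrite sc' c'a n'n => /(_ (ltnW (ltnW L_ge3))) na.
have [k Lk] : exists k, L = k.+2 by exists L.-2; arith.
have xc' : x \notin c' by rewrite c'c.
have yc' : y \notin c' by rewrite c'c.
have nonc z i : z \notin c' -> i.+1 < L -> e z (nth a c' i) -> ~~ e z (nth a c' i.+1).
  move=> zc' iL; rewrite -next_nth_lt ?sc' //.
  have ic : nth a c' i \in c' by apply: mem_nth; rewrite sc' ltnW.
  exact: next_nonadj lc' zc' ic.
have cp i i' : i < i' < L -> e y (nth a c' i) -> e x (nth a c' i') -> i.+2 < i'.
  move=> ii yi xi.
  by apply: (cross_pair (x0 := a) e_sym L_max lc' xy xc' yc' ii) => //; rewrite -?na ?c'a.
have := @window_sum (fun i => e x (nth a c' i)) (fun i => e y (nth a c' i)) k.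
rewrite -na xa => /(_ isT).
have -> : ~~ e x (nth a c' 1) by apply: nonc; rewrite -?na // ltnW.
have kL : k.+1 = L.-1 by rewrite Lk.
have ax : ~~ e x a by apply: contraL xa => /(next_nonadj e_sym L_max lc xc ac).
have k1L : k.+1 < L by rewrite Lk.
have ky : ~~ e y (nth a c' k).
  by apply: contraL (ya) => /(nonc y k yc' k1L); rewrite kL c'a.
rewrite kL c'a ax ya ky -kL => /(_ isT isT isT isT).
have H1 i : i < k -> ~~ (e x (nth a c' i.+1) && e x (nth a c' i.+2)).
  move=> ik; have iL : i.+2 < L by rewrite Lk.
  by apply/negP => /andP[/(nonc x i.+1 xc' iL)/negPf->].
have H2 i : i < k -> ~~ (e y (nth a c' i) && e x (nth a c' i.+1)).
  move=> ik; have iL : i < i.+1 < L by rewrite Lk; arith.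
  by apply/negP => /andP[yi /(cp i i.+1 iL yi)]; arith.
have H3 i : i < k -> ~~ (e y (nth a c' i) && e x (nth a c' i.+2)).
  move=> ik; have iL : i < i.+2 < L by rewrite Lk; arith.
  by apply/negP => /andP[yi /(cp i i.+2 iL yi)]; arith.
move=> /(_ H1 H2 H3); rewrite -Lk -sc' -!count_nat_sum.
have cnt z : z \notin c' -> count (e z) c' = #|N z|.
  by move=> zc'; symmetry; apply: card_nbr_count => // w; apply: nbr_in lc' zc'.
rewrite !cnt // => bnd; have := deg_ge x; have := deg_ge y.
have h3' : k.+2 + 3 <= #|T| by rewrite -Lk.
by move: (#|N x|) (#|N y|) bnd h3' card_le => p r; arith.
Qed.

(** Otherwise the union [U] of the two neighbourhoods has at least [2 * d] vertices. It meets its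
    shift along the cycle in at most two, by [next_next_common] used in both directions, so
    [4 * d <= L + 2], whereas [L + 2 <= 3 * d + 1]. *)
Lemma common_nbr c x y : lcyc c -> x \notin c -> y \notin c -> x != y ->
  exists2 v, e x v & e y v.
Proof.
move=> lc xc yc xy.
have [/pred0Pn[v /andP[]]|none] := boolP (~~ [disjoint N x & N y]).
  by rewrite !inE; exists v.
pose nx := next c; have ninj : injective nx := lcycle_inj lc.
have Nc z u : z \notin c -> u \in N z -> u \in c by rewrite inE => zc; apply: nbr_in lc zc.
have one z w : z \notin c -> w \notin c -> z != w -> #|(nx @: N z) :&: N w| <= 1.
  move=> zc wc zw; rewrite leqNgt; apply/negP => /card_gt1P[p [q []]].
  rewrite !inE => /andP[/imsetP[a az ->] wa] /andP[/imsetP[b bz ->] wb] ab.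
  have ac := Nc _ _ zc az; have bc := Nc _ _ zc bz; rewrite !inE in az bz.
  have nab : a != b by apply: contraNneq ab => ->.
  by have := next_next_common e_sym L_max lc zc wc zw ac bc nab az bz wa; rewrite wb.
have zero z : z \notin c -> (nx @: N z) :&: N z = set0.
  move=> zc; apply/setP => p; rewrite !inE; apply/negP => /andP[/imsetP[a az ->]].
  apply/negP; have ac := Nc _ _ zc az; rewrite inE in az.
  exact: next_nonadj lc zc ac az.
set U := N x :|: N y.
have cU : #|U| = #|N x| + #|N y|.
  by rewrite cardsU (disjoint_setI0 (negbNE none)) cards0 subn0.
have UI : #|(nx @: U) :&: U| <= 2.
  have -> : (nx @: U) :&: U = ((nx @: N x) :&: N y) :|: ((nx @: N y) :&: N x).
    have -> : nx @: U = (nx @: N x) :|: (nx @: N y) by exact: imsetU.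
    by rewrite /U setIUl 2!setIUr (zero x xc) (zero y yc) set0U setU0.
  apply: leq_trans (leq_card_setU _ _) _.
  by apply: (@leq_add _ _ 1 1); apply: one; rewrite // eq_sym.
have : #|(nx @: U) :|: U| <= L.
  apply: (card_in_cycle lc) => p.
  have Uc v : v \in U -> v \in c by rewrite !inE => /orP[/(nbr_in lc xc)|/(nbr_in lc yc)].
  by rewrite inE => /orP[/imsetP[a /Uc ac ->]|/Uc//]; rewrite mem_next.
have cnx : #|nx @: U| = #|U| by apply: card_imset.
rewrite (cardsU (nx @: U)) cnx cU => bnd; exfalso.
have out2 : L + 2 <= #|T|.
  rewrite -(card_outside lc) addnC leq_add2r.
  by apply/card_gt1P; exists x, y; rewrite !inE.
have dx := deg_ge x; have dy := deg_ge y.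
have : 4 * d <= L + 2.
  apply: leq_trans (_ : 2 * (#|N x| + #|N y|) <= _).
    by rewrite -[4]/(2 * 2) -mulnA leq_mul2l /= mul2n -addnn leq_add.
  rewrite (addnC L) -leq_subLR (leq_trans _ bnd) // mul2n -addnn.
  by rewrite leq_sub2l.
by have := leq_trans out2 card_le; arith.
Qed.

(** * Slots and double counting with at least three vertices outside *)

Section Count.

Hypothesis outside3 : L + 3 <= #|T|.
Variable c : seq T.
Hypothesis lc : lcyc c.

(* The members of [slots y] are the vertices that [y] may replace in the cycle. *)
Definition attach := [set u | [exists y, (y \notin c) && e y u]].
Definition slots y := [set z in c | e y (prev c z) && e y (next c z)].
Definition slot_nbrs :=
  [set u | [exists y, [exists z, [&& y \notin c, z \in slots y & e u z]]]].
Definition hull := attach :|: slot_nbrs.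

Let uc : uniq c := lcycle_uniq lc.

Lemma attachP u : reflect (exists2 y, y \notin c & e y u) (u \in attach).
Proof.
rewrite inE; apply: (iffP existsP) => [[y /andP[]]|[y yc yu]]; first by exists y.
by exists y; rewrite yc.
Qed.

Lemma slot_nbrsP u : reflect (exists y z, [/\ y \notin c, z \in slots y & e u z])
  (u \in slot_nbrs).
Proof.
rewrite inE; apply: (iffP existsP) => [[y /existsP[z /and3P[]]]|[y [z [yc zy uz]]]].
  by exists y, z.
by exists y; apply/existsP; exists z; rewrite yc zy.
Qed.

Lemma slotsP y z : reflect [/\ z \in c, e y (prev c z) & e y (next c z)] (z \in slots y).
Proof. by rewrite inE; apply: and3P. Qed.

Lemma attach_in u : u \in attach -> u \in c.
Proof. by case/attachP => y yc; apply: nbr_in lc yc. Qed.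

Lemma attach_next u : u \in attach -> next c u \notin attach.
Proof.
move=> ua; have ucc := attach_in ua; case/attachP: ua => y yc yu.
apply/attachP => -[x xc]; apply/negP; case: (eqVneq x y) => [->|xy].
  exact: (next_nonadj e_sym L_max lc yc ucc yu).
exact: no_bad_pair outside3 lc ucc xc yc xy yu.
Qed.

Lemma slots_nattach y z : y \notin c -> z \in slots y -> z \notin attach.
Proof.
move=> yc /slotsP[zc yp _]; rewrite -[z](next_prev uc).
by apply: attach_next; apply/attachP; exists y.
Qed.

(** No outside vertex is adjacent to a slot, so [swap_cycle] can make all the replacements at
    once. *)
Lemma slots_swap (M : {set T}) (zf : T -> T) : {in M &, injective zf} ->
  {in M, forall y, y \notin c} -> {in M, forall y, zf y \in slots y} ->
  exists c', [/\ lcyc c',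
     forall v, (v \in c') = (v \in c) && (v \notin zf @: M) || (v \in M) &
     forall u, u \in c -> u \notin zf @: M -> next c u \notin zf @: M ->
       next c' u = next c u].
Proof.
move=> zinj Mc zs; apply: (swap_cycle e_sym lc zinj Mc) => [y /zs/slotsP //|y y' yM y'M].
apply: contra (slots_nattach (Mc y yM) (zs y yM)) => yz.
by apply/attachP; exists y'; first exact: Mc.
Qed.

Lemma slot_swap y z : y \notin c -> z \in slots y ->
  exists c', [/\ lcyc c', forall v, (v \in c') = (v \in c) && (v != z) || (v == y) &
     forall u, u \in c -> u != z -> next c u != z -> next c' u = next c u].
Proof.
move=> yc zy; have [|w|w|c' [lc' mc' nc']] := @slots_swap [set y] (fun=> z).
- by move=> a b; rewrite !inE => /eqP-> /eqP->.
- by rewrite inE => /eqP->.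
- by rewrite inE => /eqP->.
exists c'; split=> [//|v|u ucc uz nz]; first by rewrite mc' imset_set1 !inE.
by apply: nc'; rewrite // imset_set1 inE.
Qed.

Lemma slots_swap2 y1 y2 z1 z2 : y1 \notin c -> y2 \notin c -> y1 != y2 -> z1 != z2 ->
  z1 \in slots y1 -> z2 \in slots y2 ->
  exists c', [/\ lcyc c', z1 \notin c', z2 \notin c',
     forall v, v \in c -> v != z1 -> v != z2 -> v \in c' &
     forall u, u \in c -> u != z1 -> u != z2 -> next c u != z1 -> next c u != z2 ->
       next c' u = next c u].
Proof.
move=> y1c y2c y12 z12 zy1 zy2.
pose zf y := if y == y1 then z1 else z2.
have zf1 : zf y1 = z1 by rewrite /zf eqxx.
have zf2 : zf y2 = z2 by rewrite /zf eq_sym (negPf y12).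
have zim : zf @: [set y1; y2] = [set z1; z2] by rewrite imsetU1 imset_set1 zf1 zf2.
have [|w|w|c' [lc' mc' nc']] := @slots_swap [set y1; y2] zf.
- move=> a b; rewrite !inE => /orP[]/eqP-> /orP[]/eqP->; rewrite ?zf1 ?zf2 // => zz.
    by rewrite zz eqxx in z12.
  by rewrite zz eqxx in z12.
- by rewrite !inE => /orP[]/eqP->.
- by rewrite in_set2 => /orP[]/eqP->; rewrite ?zf1 ?zf2.
have zc y z : z \in slots y -> z \in c by case/slotsP.
exists c'; split=> [//|||v vc v1 v2|u ucc u1 u2 n1 n2].
- rewrite mc' zim !inE eqxx andbF /=; apply/norP.
  by split; apply: contraL (zc _ _ zy1) => /eqP->.
- rewrite mc' zim !inE eqxx orbT andbF /=; apply/norP.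
  by split; apply: contraL (zc _ _ zy2) => /eqP->.
- by rewrite mc' zim vc !inE negb_or v1 v2.
by apply: nc'; rewrite // zim !inE negb_or ?u1 ?n1.
Qed.

(** For distinct [y1] and [y2] both slots can be moved outside, where no two vertices are adjacent;
    for a common [y1] they are successors of two neighbours of one outside vertex. *)
Lemma slots_indep y1 y2 z1 z2 : y1 \notin c -> y2 \notin c ->
  z1 \in slots y1 -> z2 \in slots y2 -> ~~ e z1 z2.
Proof.
move=> y1c y2c zy1 zy2; case: (eqVneq z1 z2) => [->|z12]; first by rewrite e_irr.
case: (eqVneq y1 y2) => [y12|y12].
  subst y2; case/slotsP: zy1 => z1c p1 _; case/slotsP: zy2 => z2c p2 _.
  rewrite -[z1](next_prev uc) -[z2](next_prev uc).
  apply: (next_next_nonadj e_sym L_max lc y1c) => //; rewrite ?mem_prev //.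
  by apply: contraNneq z12 => pp; rewrite -[z1](next_prev uc) pp (next_prev uc).
have [c' [lc' z1c' z2c' _ _]] := slots_swap2 y1c y2c y12 z12 zy1 zy2.
exact: outside_indep lc' _ _ z1c' z2c'.
Qed.

Lemma hull_in u : u \in hull -> u \in c.
Proof.
rewrite inE => /orP[/attach_in //|/slot_nbrsP[y [z [yc zy uz]]]].
apply: contraNT (slots_nattach yc zy) => nuc.
by apply/attachP; exists u.
Qed.

Lemma slots_nhull y z : y \notin c -> z \in slots y -> z \notin hull.
Proof.
move=> yc zy; rewrite inE negb_or (slots_nattach yc zy) /=.
by apply/slot_nbrsP => -[y' [z' [y'c zy']]]; apply/negP; apply: slots_indep zy zy'.
Qed.

(** With [u] in the last position, a slot other than [u] and [next c u] has both cycle-neighbours at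
    adjacent indices, without wrapping around. *)
Lemma slot_index c' u y z : lcyc c' -> c' =i c -> next c' =1 next c ->
  nth u c' L.-1 = u -> z \in slots y -> z != u -> z != next c u ->
  exists i, [/\ 0 < i, i.+1 < L, nth u c' i = z, e y (nth u c' i.-1) & e y (nth u c' i.+1)].
Proof.
move=> lc' c'c n'n c'u /slotsP[zc yp yn] zu znu.
have uc' := lcycle_uniq lc'; have sc' := lcycle_size lc'.
have zc' : z \in c' by rewrite c'c.
set i := index z c'.
have iz : nth u c' i = z by rewrite nth_index.
have iL : i < L by rewrite -sc' index_mem.
have L0 : 0 < L by arith.
have := next_nth_last u uc'; rewrite sc' c'u n'n => /(_ L0) nu.
have i0 : 0 < i by rewrite lt0n; apply: contraNneq znu => i0; rewrite nu -iz i0.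
have iL1 : i.+1 < L.
  have : i != L.-1 by apply: contraNneq zu => il; rewrite -iz il c'u.
  by arith.
exists i; split=> //.
  suff <- : prev c z = nth u c' i.-1 by [].
  apply: (can_inj (prev_next uc)); rewrite (next_prev uc) -n'n next_nth_lt ?sc' ?prednK //.
by rewrite -next_nth_lt ?sc' // iz n'n.
Qed.

(** If [u] and [next c u] get their membership from different outside vertices, exchanging the slots
    involved moves these slots outside and gives a pair excluded by [no_bad_pair]; if a single slot
    serves both, [next_nonadj] applies after the exchange. If a single outside vertex serves both,
    it is inserted by one of the [hop] lemmas. *)
Lemma hull_next u : u \in hull -> next c u \notin hull.
Proof.
move=> uh; have ucc := hull_in uh.
have [c' [lc' c'c n'n c'u]] := rotate_last u lc ucc.
have L0 : 0 < L by arith.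
have := next_nth_last u (lcycle_uniq lc').
rewrite (lcycle_size lc') c'u n'n => /(_ L0) nu.
have yc' y : y \notin c -> y \notin c' by rewrite c'c.
have ieq z w : e z w -> w != z by move=> zw; apply: contraTneq zw => ->; rewrite e_irr.
apply/negP => nh; move: (uh) (nh); rewrite !in_setU.
move=> /orP[ua|/slot_nbrsP[y1 [z1 [y1c zy1 uz1]]]] /orP[na|/slot_nbrsP[y2 [z2 [y2c zy2 uz2]]]].
- by have := attach_next ua; rewrite na.
- have z2u : z2 != u by apply: contraTneq ua => <-; apply: slots_nattach zy2.
  have z2n : z2 != next c u by apply: ieq.
  case/attachP: ua => y1 y1c yu; case: (eqVneq y2 y1) => [y21|y21].
    subst y2; have [i [i0 iL iz yp _]] := slot_index lc' c'c n'n c'u zy2 z2u z2n.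
    have := hop_last (x0 := u) e_sym L_max lc' (yc' _ y1c) (j := i).
    rewrite i0 (ltnW iL) c'u iz -nu => /(_ isT); rewrite e_sym => /(_ yp yu).
    by rewrite e_sym uz2.
  have [c2 [lc2 mc2 nc2]] := slot_swap y2c zy2.
  have z2y2 : z2 != y2 by apply: contraNneq y2c => <-; case/slotsP: zy2.
  have z2y1 : z2 != y1 by apply: contraNneq y1c => <-; case/slotsP: zy2.
  have uc2 : u \in c2 by rewrite mc2 ucc eq_sym z2u.
  have z2c2 : z2 \notin c2 by rewrite mc2 eqxx andbF.
  have y1c2 : y1 \notin c2 by rewrite mc2 (negPf y1c) /= eq_sym.
  have := no_bad_pair outside3 lc2 uc2 z2c2 y1c2 z2y1 yu.
  by rewrite nc2 // 1?eq_sym // (e_sym z2) uz2.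
- have z1n : z1 != next c u by apply: contraTneq na => <-; apply: slots_nattach zy1.
  have z1u : z1 != u by apply: ieq.
  case/attachP: na => y2 y2c yn; case: (eqVneq y2 y1) => [y21|y21].
    subst y2; have [i [i0 iL iz _ yi]] := slot_index lc' c'c n'n c'u zy1 z1u z1n.
    have := hop_first (x0 := u) e_sym L_max lc' (yc' _ y1c) iL.
    by rewrite -nu e_sym yn yi iz c'u uz1 => /(_ isT isT).
  have [c2 [lc2 mc2 nc2]] := slot_swap y1c zy1.
  have z1y1 : z1 != y1 by apply: contraNneq y1c => <-; case/slotsP: zy1.
  have z1y2 : z1 != y2 by apply: contraNneq y2c => <-; case/slotsP: zy1.
  have uc2 : u \in c2 by rewrite mc2 ucc eq_sym z1u.
  have z1c2 : z1 \notin c2 by rewrite mc2 eqxx andbF.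
  have y2c2 : y2 \notin c2 by rewrite mc2 (negPf y2c).
  have y2z1 : y2 != z1 by rewrite eq_sym.
  have z1u' : e z1 u by rewrite e_sym.
  have := no_bad_pair outside3 lc2 uc2 y2c2 z1c2 y2z1 z1u'.
  by rewrite nc2 // 1?eq_sym // yn.
have z1n : z1 != next c u by apply: contraTneq nh => <-; apply: slots_nhull zy1.
have z2u : z2 != u by apply: contraTneq uh => <-; apply: slots_nhull zy2.
have z1u : z1 != u by apply: ieq.
have z2n : z2 != next c u by apply: ieq.
case: (eqVneq z1 z2) => [z12|z12].
  subst z2; have [c2 [lc2 mc2 nc2]] := slot_swap y1c zy1.
  have z1y1 : z1 != y1 by apply: contraNneq y1c => <-; case/slotsP: zy1.
  have uc2 : u \in c2 by rewrite mc2 ucc eq_sym z1u.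
  have z1c2 : z1 \notin c2 by rewrite mc2 eqxx andbF.
  have z1u' : e z1 u by rewrite e_sym.
  have := next_nonadj e_sym L_max lc2 z1c2 uc2 z1u'.
  by rewrite nc2 // 1?eq_sym // (e_sym z1) uz2.
case: (eqVneq y1 y2) => [y12|y12]; last first.
  have [c2 [lc2 z1c2 z2c2 mc2 nc2]] := slots_swap2 y1c y2c y12 z12 zy1 zy2.
  have uc2 : u \in c2 by rewrite mc2 // eq_sym.
  have z21 : z2 != z1 by rewrite eq_sym.
  have z1u' : e z1 u by rewrite e_sym.
  have := no_bad_pair outside3 lc2 uc2 z2c2 z1c2 z21 z1u'.
  by rewrite nc2 // 1?eq_sym // (e_sym z2) uz2.
subst y2.
have [i [i0 iL iz ip inn]] := slot_index lc' c'c n'n c'u zy1 z1u z1n.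
have [j [j0 jL jz jp jn]] := slot_index lc' c'c n'n c'u zy2 z2u z2n.
have ij : i != j by apply: contraNneq z12 => ij; rewrite -iz -jz ij.
have y1c' := yc' _ y1c.
have [ltij|leji] := ltnP i j.
  have := hop_lt (x0 := u) L_max lc' y1c' (i := i) (j := j).
  by rewrite i0 ltij (e_sym _ y1) ip jn c'u iz uz1 jz -nu (e_sym z2) uz2 => /(_ isT jL isT isT isT).
have ltji : j < i by rewrite ltn_neqAle eq_sym ij.
have := hop_gt (x0 := u) e_sym L_max lc' y1c' (i := i) (j := j).
by rewrite j0 ltji (e_sym _ y1) jp inn c'u iz uz1 jz -nu (e_sym z2) uz2 => /(_ isT iL isT isT isT).
Qed.

(* Otherwise all outside vertices that are not adjacent to [u] can simultaneously
   be exchanged against distinct neighbours of [u] on the cycle, and [u] becomes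
   the center of a spanning jellyfish. *)
Lemma slots_choice u : u \in c ->
  exists2 y, y \notin c &
    #|slots y :&: N u| < #|[set y in [set x | x \notin c] | ~~ e u y]|.
Proof.
move=> ucc; set M := [set y in _ | _].
have MP y : y \in M -> y \notin c /\ ~~ e u y by rewrite !inE => /andP[].
have [/existsP[y /andP[yc small]]|none] :=
  boolP [exists y, (y \notin c) && (#|slots y :&: N u| < #|M|)]; first by exists y.
have big : {in enum M, forall y, size (enum M) <= #|slots y :&: N u|}.
  move=> y; rewrite mem_enum -cardE leqNgt => /MP[yc _].
  by apply: contra none => small; apply/existsP; exists y; rewrite yc.
have [zf [zinj zs]] := distinct_representatives (enum_uniq M) big.
have zs' y : y \in M -> zf y \in slots y /\ e u (zf y).
  by move=> yM; have := zs y; rewrite mem_enum => /(_ yM); rewrite inE [_ \in N u]inE => /andP[].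
have [|y /MP[]//|y /zs'[]//|c' [lc' mc' _]] := @slots_swap M zf.
  by move=> a b aM bM; apply: zinj; rewrite mem_enum.
have uz : u \notin zf @: M.
  by apply/imsetP => -[y /zs'[_ uzy] uE]; rewrite -uE e_irr in uzy.
have uc' : u \in c' by rewrite mc' ucc uz.
have [x xc' ux] := no_jelly lc' uc'.
move: xc'; rewrite mc' negb_or negb_and negbK => /andP[/orP[xc|/imsetP[y /zs'[_ uzy] xE]] xM].
  by rewrite !inE xc ux in xM.
by rewrite xE uzy in ux.
Qed.

Let nbr_attach y : y \notin c -> N y \subset attach.
Proof. by move=> yc; apply/subsetP => u; rewrite inE => yu; apply/attachP; exists y. Qed.

(** Vertices with both cycle-neighbours in [attach], possibly on account of different outside
    vertices. *)
Definition gaps1 := (next c @: attach) :&: (prev c @: attach).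

Lemma slots_gaps1 y : y \notin c -> slots y \subset gaps1.
Proof.
move=> yc; apply/subsetP => z /slotsP[zc yp yn]; rewrite inE; apply/andP; split.
  by apply/imsetP; exists (prev c z); rewrite ?next_prev //; apply/attachP; exists y.
by apply/imsetP; exists (next c z); rewrite ?prev_next //; apply/attachP; exists y.
Qed.

(** A member of [gaps1] that is no slot of [y] is next to a member of [attach] missed by [y]; there
    are at most [#|attach| - d] of the latter, each with two cycle-neighbours. *)
Lemma card_gaps1_slots y : y \notin c ->
  #|gaps1| <= #|slots y| + 2 * (#|attach| - d).
Proof.
move=> yc; set R := attach :\: N y.
have cR : #|R| <= #|attach| - d.
  by rewrite cardsD (setIidPr (nbr_attach yc)) leq_sub2l.
have sub : gaps1 \subset slots y :|: ((next c @: R) :|: (prev c @: R)).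
  apply/subsetP => z; rewrite inE => /andP[/imsetP[a aO ->] /imsetP[b bO abE]].
  have bE : next c (next c a) = b by rewrite abE next_prev.
  rewrite inE; case: (boolP (next c a \in slots y)) => //= nz; rewrite inE.
  case: (boolP (e y a)) => ya; last first.
    by apply/orP; left; apply/imsetP; exists a => //; rewrite in_setD inE ya aO.
  apply/orP; right; rewrite abE; apply/imsetP; exists b => //; rewrite in_setD inE bO andbT.
  apply: contra nz => yb; apply/slotsP; rewrite mem_next prev_next // bE.
  by split=> //; apply: attach_in.
apply: leq_trans (subset_leq_card sub) _; apply: leq_trans (leq_card_setU _ _) _.
rewrite leq_add2l; apply: leq_trans (leq_card_setU _ _) _.
rewrite (card_imset _ (can_inj (prev_next uc))) (card_imset _ (can_inj (next_prev uc))).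
by rewrite mul2n -addnn leq_add.
Qed.

(** The set [attach] is disjoint from its two shifts, and these meet in [gaps1]. *)
Lemma card_gaps1 : 3 * #|attach| <= L + #|gaps1|.
Proof.
have ninj : injective (next c) := lcycle_inj lc.
have pinj : injective (prev c) by apply: can_inj (next_prev uc).
have dis : [disjoint attach & (next c @: attach) :|: (prev c @: attach)].
  apply/pred0P => u; apply/negP => /andP[/= ua]; rewrite inE => /orP[]/imsetP[a aa uE].
    by have := attach_next aa; rewrite -uE ua.
  by have := attach_next ua; rewrite uE next_prev // aa.
have : #|attach :|: ((next c @: attach) :|: (prev c @: attach))| <= L.
  apply: (card_in_cycle lc) => u; rewrite !in_setU.
  case/orP=> [|/orP[]]; first exact: attach_in.
    by case/imsetP => a /attach_in ac ->; rewrite mem_next.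
  by case/imsetP => a /attach_in ac ->; rewrite mem_prev.
rewrite cardsU (disjoint_setI0 dis) cards0 subn0 cardsU !card_imset //.
have : #|gaps1| <= #|attach|.
  by rewrite (leq_trans (subset_leq_card (subsetIl _ _))) // card_imset.
by rewrite -/gaps1; arith.
Qed.

Lemma card_hull : 2 * #|hull| <= L.
Proof.
have ninj : injective (next c) := lcycle_inj lc.
have : #|hull :|: next c @: hull| <= L.
  apply: (card_in_cycle lc) => u; rewrite inE => /orP[/hull_in //|/imsetP[a /hull_in ac ->]].
  by rewrite mem_next.
have dis : [disjoint hull & next c @: hull]; last first.
  by rewrite cardsU (disjoint_setI0 dis) cards0 subn0 card_imset // mul2n addnn.
apply/pred0P => u; apply/negP => /andP[/= uh /imsetP[a ah uE]].
by have := hull_next ah; rewrite -uE uh.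
Qed.

(* Double counting of the nonadjacent pairs between [hull] and the slots. *)
Lemma three_outside_absurd : False.
Proof.
pose H := [set x | x \notin c].
pose Z := \bigcup_(y in H) slots y.
have hL := card_outside lc; rewrite -/H in hL.
have [y0 y0c] : exists y0, y0 \notin c.
  have : 0 < #|H| by move: outside3; rewrite -hL; arith.
  by case/card_gt0P => y; rewrite inE; exists y.
have dO : d <= #|attach|.
  exact: leq_trans (deg_ge y0) (subset_leq_card (nbr_attach y0c)).
have Os : #|attach| <= #|hull| by apply/subset_leq_card/subsetUl.
have qq : #|Z| <= #|gaps1|.
  by apply/subset_leq_card/bigcupsP => y; rewrite inE => /slots_gaps1.
have nonadj w : N w \subset hull -> #|[set u in hull | ~~ e w u]| <= #|hull| - d.
  move=> sub; have -> : [set u in hull | ~~ e w u] = hull :\: N w.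
    by apply/setP => u; rewrite !inE andbC.
  by rewrite cardsD (setIidPr sub) leq_sub2l.
have NZ z : z \in Z -> N z \subset hull.
  case/bigcupP => y; rewrite inE => yc zy; apply/subsetP => u; rewrite !inE => zu.
  apply/orP; right; apply/existsP; exists y; apply/existsP; exists z.
  by rewrite yc zy e_sym.
have NH y : y \in H -> N y \subset hull.
  by rewrite inE => yc; apply: subset_trans (nbr_attach yc) (subsetUl _ _).
apply: (@counting_bound d L #|H| #|attach| #|gaps1| #|Z| #|hull|) => //.
- by move: outside3; rewrite -hL; arith.
- by rewrite addnC hL.
- exact: card_hull.
- exact: card_gaps1.
have sumle (B : {set T}) : {in B, forall w, N w \subset hull} ->
    \sum_(u in hull) #|[set w in B | ~~ e u w]| <= #|B| * (#|hull| - d).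
  move=> Bh; rewrite exchange_nonadj // -sum_nat_const.
  by apply: leq_sum => w /Bh/nonadj.
apply: leq_trans (leq_add (leq_add (sumle Z NZ) (sumle H NH)) (leqnn _)).
rewrite -2!sum_nat_const -!big_split /=; apply: leq_sum => u /hull_in ucc.
(* For fixed [u], this [y] shows that [#|gaps1|] is less than the sum of the three terms belonging
   to [u]. *)
have [y yc small] := slots_choice ucc.
have := card_gaps1_slots yc; rewrite -/H in small *.
have : #|slots y| <= #|slots y :&: N u| + #|[set z in Z | ~~ e u z]|.
  rewrite -(cardsID (N u) (slots y)) leq_add2l; apply: subset_leq_card.
  apply/subsetP => z; rewrite in_setD in_set => /andP[uz zy]; rewrite in_set uz andbT.
  by apply/bigcupP; exists y; first rewrite inE.
by move: small; arith.
Qed.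

End Count.

(** A common neighbour of all outside vertices would be a center. One vertex outside has a neighbour
    and two have a common one, so at least three lie outside. *)
Lemma dominating_absurd c : lcyc c -> False.
Proof.
move=> lc; have hL := card_outside lc.
have [v vc] : exists v, v \in c.
  have := lcycle_size lc; case: (c) => [s0|v s _]; first by move: L_ge3; rewrite -s0.
  by exists v; rewrite mem_head.
have [x xc vx] := no_jelly lc vc.
have two : exists y, y \notin c /\ y != x.
  have [w xw] : exists w, e x w.
    have /card_gt0P[w] : 0 < #|N x| by apply: leq_trans (deg_ge x); apply: ltnW.
    by rewrite inE; exists w.
  have wc := nbr_in lc xc xw.
  have [y yc wy] := no_jelly lc wc; exists y; split=> //.
  by apply: contraNneq wy => ->; rewrite e_sym.
have [y [yc yx]] := two.
have xy : x != y by rewrite eq_sym.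
have [w xw yw] := common_nbr lc xc yc xy.
have wc := nbr_in lc xc xw; have [z zc wz] := no_jelly lc wc.
apply: (@three_outside_absurd _ c) => //.
rewrite -hL addnC leq_add2r.
apply/card_gt2P; exists x, y, z; rewrite !inE; split=> //; split=> //.
  by apply: contraNneq wz => <-; rewrite e_sym.
by apply: contraNneq wz => ->; rewrite e_sym.
Qed.

End Dominating.

(** * Longest cycles with a nontrivial component outside *)

(** Among [U i.+1], [W i] and [S i] only the last two can hold together, and then all three fail for
    the next index. The boolean term in [step] is the debt that this next index repays. *)
Lemma half_sum (U W S : nat -> bool) b : ~~ U 0 -> S b ->
  (forall i, i < b -> ~~ (W i && U i.+1)) ->
  (forall i, i.+1 < b -> ~~ (W i && U i.+2)) ->
  (forall i, i < b -> ~~ (S i && U i.+1)) ->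
  (forall i, i < b -> ~~ (S i && W i.+1)) ->
  (forall i, i < b -> ~~ (S i && S i.+1)) ->
  \sum_(0 <= i < b.+1) U i + \sum_(0 <= i < b.+1) W i + \sum_(0 <= i < b.+1) S i <= b.+2.
Proof.
move=> U0 Sb WU WUU SU SW SS.
have step k : k <= b -> \sum_(0 <= i < k.+1) U i + \sum_(0 <= i < k) W i
    + \sum_(0 <= i < k) S i <= k + ((0 < k) && S k.-1 && W k.-1).
  elim: k => [|k IH] kb; first by rewrite big_nat1 !big_geq // (negPf U0).
  have := IH (ltnW kb); rewrite big_nat_recr //= => IHk.
  rewrite [\sum_(0 <= i < k.+2) _]big_nat_recr //= !(big_nat_recr k) //=.
  have := WU k kb; have := SU k kb.
  have prev : (0 < k) && S k.-1 && W k.-1 -> [&& ~~ W k, ~~ S k & ~~ U k.+1].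
    case: k kb {IH IHk} => // k kb /= /andP[Sk Wk].
    have := SW k (ltnW kb); have := SS k (ltnW kb); have := WUU k kb.
    by rewrite Sk Wk => -> -> ->.
  move: IHk prev; case: (_ && W k.-1) => [|] IHk.
    by move=> /(_ isT) /and3P[/negPf-> /negPf-> /negPf->]; rewrite /=; arith.
  by move=> _; case: (U k.+1); case: (W k); case: (S k); rewrite //=; arith.
have := step b (leqnn b); rewrite !(big_nat_recr b) //= Sb.
have -> : (0 < b) && S b.-1 && W b.-1 = false.
  apply/negbTE; case: b Sb SS {WU WUU SU SW step} => // b Sb SS /=.
  by have := SS b (leqnn _); rewrite Sb andbT => /negPf->.
by case: (W b); rewrite /=; arith.
Qed.

(** Induction on [n]: a hit in the last place forces the [D] places before it to be empty. *)
Lemma spaced_sum (F : nat -> bool) D n :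
  (forall i j, i < j < n -> F i -> F j -> i + D < j) ->
  D.+1 * (\sum_(0 <= i < n) F i) <= n + D.
Proof.
elim/ltn_ind: n => n IH sp; case: n IH sp => [|n] IH sp; first by rewrite big_geq // muln0.
rewrite big_nat_recr //=; case Fn: (F n); last first.
  rewrite addn0; apply: leq_trans (IH n (ltnSn n) _) _; last by rewrite addSn leqnSn.
  by move=> i j ij; apply: sp; case/andP: ij => -> /ltnW.
have zero i : n - D <= i < n -> F i = false.
  move=> /andP[Di iN]; apply/negbTE/negP => Fi.
  have ilt : i < n < n.+1 by rewrite iN /=.
  by have := sp i n ilt Fi Fn; arith.
have -> : \sum_(0 <= i < n) F i = \sum_(0 <= i < n - D) F i.
  have z0 : \sum_(n - D <= i < n) F i = 0 by rewrite big_nat big1 // => i /zero->.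
  by rewrite (big_cat_nat (n := n - D)) ?leq_subr //= z0 addn0.
have lt1 : n - D < n.+1 by arith.
have sp' i j : i < j < n - D -> F i -> F j -> i + D < j.
  by move=> ij; apply: sp; arith.
have := IH (n - D) lt1 sp'; case: (leqP n D) => nD.
  have -> : n - D = 0 by arith.
  by rewrite big_geq // => _; rewrite muln1; arith.
by rewrite mulnDr muln1; arith.
Qed.

(** If the path condition fails, [y] is adjacent to two consecutive vertices and fits between
    them. *)
Lemma insert_link (T : finType) (e : rel T) (y x z : T) (k : seq T) : symmetric e ->
  link e k x z -> ~~ path (fun u v => ~~ (e y u && e y v)) x (rcons k z) ->
  exists2 k', link e k' x z & perm_eq k' (y :: k).
Proof.
move=> e_sym; elim: k x => [|w k IH] x.
  rewrite link0 /= andbT negbK => xz /andP[yx yz]; exists [:: y] => //.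
  by rewrite link1 e_sym yx.
rewrite /link /= => /andP[xw wk]; rewrite negb_and negbK => /orP[/andP[yx yw]|].
  by exists [:: y, w & k]; rewrite //= e_sym yx yw.
case/(IH w wk) => k' lk' pk'; exists (w :: k'); first by rewrite rcons_cons /= xw.
by apply: (@perm_trans _ [:: w, y & k]); rewrite ?perm_cons // (perm_catCA [:: w] [:: y] k).
Qed.

Lemma sparse_path (T : Type) (P : pred T) x (l : seq T) :
  path (fun u v => ~~ (P u && P v)) x l ->
  size l + ~~ P x <= 2 * count (predC P) (x :: l).
Proof.
elim: l x => [|v l IH] x /=; first by case: (P x).
by move=> /andP[xv /IH] /=; move: xv; case: (P x); case: (P v) => //= _; arith.
Qed.

Lemma nth_rot (T : Type) (x0 : T) n (s : seq T) i : n <= size s -> i < size s ->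
  nth x0 (rot n s) i = nth x0 s (if i < size s - n then n + i else i - (size s - n)).
Proof.
move=> ns is_; rewrite /rot nth_cat size_drop; case: ifP => ilt; first by rewrite nth_drop.
by rewrite nth_take //; arith.
Qed.

(** * Components of the complement of a cycle *)

Section Component.

Variables (T : finType) (e : rel T).
Hypothesis e_sym : symmetric e.
Variable c : seq T.

Definition outside_edge : rel T := [rel x y | [&& x \notin c, y \notin c & e x y]].
Definition component x := [set y | connect outside_edge x y].

Lemma component_self x : x \in component x.
Proof. by rewrite inE connect0. Qed.

Lemma component_outside x y : x \notin c -> y \in component x -> y \notin c.
Proof.
rewrite inE => xc /connectP[p xp ->]; elim: p x xc xp => //= z p IH x _.
by move=> /andP[/and3P[_ zc _]]; apply: IH.
Qed.

Lemma component_closed x y z : x \notin c -> y \in component x -> z \notin c -> e y z ->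
  z \in component x.
Proof.
move=> xc yx zc yz; have yc := component_outside xc yx; move: yx; rewrite !inE => xy.
by apply: connect_trans xy (connect1 _); apply/and3P.
Qed.

Lemma outside_edge_sym : symmetric outside_edge.
Proof. by move=> x y; rewrite /outside_edge /= e_sym andbCA. Qed.

Lemma component_path x y z : x \notin c -> y \in component x -> z \in component x ->
  exists p, [/\ path e y p, last y p = z, uniq (y :: p) & {subset y :: p <= component x}].
Proof.
move=> xc yx zx.
have : connect outside_edge y z.
  apply: (@connect_trans _ _ x); last by rewrite inE in zx.
  by rewrite (sym_connect_sym outside_edge_sym); rewrite inE in yx.
case/connectP => p /shortenP[p' yp' up' _ zE]; exists p'; split=> //.
  by apply: sub_path yp' => u v /and3P[].
elim: p' y yx yp' {up' zE} => [|w p' IH] y yx /= => [_ v|/andP[/and3P[yc wc yw] wp] v].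
  by rewrite inE => /eqP->.
rewrite inE => /orP[/eqP-> //|]; apply: (IH w) => //.
exact: component_closed yx wc yw.
Qed.

End Component.

Section NonDominating.

Variables (T : finType) (e : rel T) (L d : nat).
Hypothesis e_sym : symmetric e.
Hypothesis e_irr : irreflexive e.
Hypothesis L_max : forall s, uniq s -> cycle e s -> size s <= L.

Local Notation lcyc := (lcycle e L).

Hypothesis L_ge3 : 3 <= L.
Hypothesis d_ge4 : 4 <= d.
Hypothesis deg_ge : forall x, d <= #|[set y | e x y]|.
Hypothesis card_le : #|T| <= 3 * d + 1.
Hypothesis conn2 : forall S : {set T}, #|S| < 2 -> connected_on e (~: S).

Variables (c : seq T) (x1 y1 : T).
Hypothesis lc : lcyc c.
(** A smallest component with an edge is chosen; this gives [m <= 2] when the two vertices outside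
    both the cycle and the component are adjacent. *)
Hypothesis component_min : forall x y, x \notin c -> y \notin c -> e x y ->
  #|component e c x1| <= #|component e c x|.
Hypothesis x1c : x1 \notin c.
Hypothesis y1c : y1 \notin c.
Hypothesis x1y1 : e x1 y1.

Local Notation N x := [set y | e x y].
Let uc : uniq c := lcycle_uniq lc.

Let K := component e c x1.
Let S := [set s in c | [exists x in K, e x s]].
Let m := #|K|.
Let sg := #|S|.
Let H' := [set z | (z \notin c) && (z \notin K)].

Let Kc x : x \in K -> x \notin c.
Proof. exact: component_outside. Qed.

Let Kclosed y z : y \in K -> z \notin c -> e y z -> z \in K.
Proof. exact: component_closed. Qed.

Let K_ge2 : 2 <= m.
Proof.
have x1K : x1 \in K by apply: component_self.
have y1K : y1 \in K by apply: Kclosed x1K y1c x1y1.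
by apply/card_gt1P; exists x1, y1; split=> //; apply: contraTneq x1y1 => ->; rewrite e_irr.
Qed.

Let SP s : reflect (s \in c /\ exists2 x, x \in K & e x s) (s \in S).
Proof.
rewrite inE; apply: (iffP andP) => -[sc].
  by case/existsP => x /andP[xK xs]; split=> //; exists x.
by case=> x xK xs; split=> //; apply/existsP; exists x; rewrite xK.
Qed.

Let Sc s : s \in S -> s \in c. Proof. by case/SP. Qed.

Let card_T : #|T| = L + m + #|H'|.
Proof.
have cc : #|[set x in c]| = L.
  by rewrite cardsE (card_uniqP uc) (lcycle_size lc).
rewrite -cc -cardsUI (_ : _ :&: _ = set0) ?cards0 ?addn0; last first.
  apply/setP => x; rewrite !inE; apply/negP => /andP[xc xK].
  by have := Kc (x := x); rewrite inE xK xc => /(_ isT).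
rewrite -cardsT -cardsUI (_ : (_ :|: _) :&: _ = set0) ?cards0 ?addn0; last first.
  apply/setP => x; rewrite !in_setI !in_setU !in_set; case: (x \in c) => //=.
  by case: (connect _ _ _).
apply: eq_card => x; rewrite !in_setU !in_set; case: (x \in c) => //=.
by case: (connect _ _ _).
Qed.

Definition detour k s s' := [&& uniq k, all (mem K) k & link e k s s'].

Let detourP k s s' : reflect [/\ uniq k, {subset k <= K} & link e k s s'] (detour k s s').
Proof. by apply: (iffP and3P) => -[u /allP k1 l]; split=> //; apply/allP. Qed.

Let detour_out k s s' : detour k s s' -> {in k, forall z, z \notin c}.
Proof. by case/detourP => _ kK _ z /kK/Kc. Qed.

Let detour_rev k s s' : detour k s s' -> detour (rev k) s' s.
Proof.
case/detourP => u kK l; apply/detourP; split; rewrite ?rev_uniq //.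
  by move=> z; rewrite mem_rev; apply: kK.
exact: link_rev.
Qed.

Let detour_ex s s' p q : p \in K -> q \in K -> e p s -> e q s' ->
  exists k, [/\ detour k s s', 0 < size k & p != q -> 1 < size k].
Proof.
move=> pK qK ps qs; have [t [pt lt ut tK]] := component_path e_sym x1c pK qK.
exists (p :: t); split=> //; last by case: (t) lt => //= <-; rewrite eqxx.
apply/detourP; split=> //; rewrite /link rcons_cons /= e_sym ps rcons_path pt lt.
exact: qs.
Qed.

Let detour_S s s' : s \in S -> s' \in S -> exists2 k, detour k s s' & 0 < size k.
Proof.
move=> /SP[_ [p pK ps]] /SP[_ [q qK qs]].
by have [k [dk k0 _]] := detour_ex pK qK ps qs; exists k.
Qed.

Let S_next s : s \in S -> next c s \notin S.
Proof.
move=> sS; apply/negP => nS; have [k /[dup] dk /detourP[u _ l] k0] := detour_S sS nS.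
have := no_link_next L_max lc (Sc sS) u (detour_out dk) k0.
by rewrite l.
Qed.

Let S_next_nonadj s t : s \in S -> t \in S -> s != t -> ~~ e (next c s) (next c t).
Proof.
move=> sS tS st; have [k /[dup] dk /detourP[u _ l] k0] := detour_S tS sS.
rewrite e_sym; have := @no_cross _ e L e_sym L_max c k [::] s t.
rewrite link0 cats0 e_sym; apply=> //; rewrite ?Sc //.
exact: detour_out dk.
Qed.

(** Two disjoint edges between [K] and the cycle come from 2-connectivity: an edge [p a] leaves [K],
    another leaves [K] avoiding [a], and if it also starts at [p], a third leaves [K :\ p] avoiding
    [p]. *)
Let reps : exists a b p q, [/\ a \in S, b \in S & a != b] /\
  [/\ p \in K, q \in K, p != q, e p a & e q b].
Proof.
have cn0 (A S0 : {set T}) : #|S0| < 2 -> [disjoint A & S0] -> forall x y,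
    x \in A -> y \notin A -> y \notin S0 ->
    exists u v, [/\ u \in A, v \notin A, v \notin S0 & e u v].
  move=> S02 AS x y xA yA yS; exact: exit_edge e_sym (conn2 S02) AS xA yA yS.
have toS u v : u \in K -> v \notin K -> e u v -> v \in S.
  move=> uK vK uv; apply/SP; split; last by exists u.
  by apply: contraNT vK => vc; apply: Kclosed uK vc uv.
have cK v : v \in c -> v \notin K by move=> vc; apply: contraL vc => /Kc.
have [v0 v0c] : exists v, v \in c.
  have := lcycle_size lc; case: (c) => [s0|v s _]; first by move: L_ge3; rewrite -s0.
  by exists v; rewrite mem_head.
have x1K : x1 \in K by apply: component_self.
have [p [a [pK aK _ pa]]] : exists u v, [/\ u \in K, v \notin K, v \notin set0 & e u v].
  have dis : [disjoint K & set0] by rewrite -setI_eq0 setI0.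
  by apply: (cn0 K set0 _ dis x1 v0); rewrite ?cards0 ?in_set0 ?cK.
have aS := toS _ _ pK aK pa.
have nac : next c a \in c by rewrite mem_next Sc.
have naa : next c a != a.
  by apply: contraTneq (lcycle_next lc (Sc aS)) => ->; rewrite e_irr.
have [p' [b [p'K bK ba p'b]]] : exists u v,
    [/\ u \in K, v \notin K, v \notin [set a] & e u v].
  have dis : [disjoint K & [set a]] by rewrite disjoint_sym disjoints1.
  by apply: (cn0 K [set a] _ dis x1 (next c a)); rewrite ?cards1 ?in_set1 ?cK.
have bS := toS _ _ p'K bK p'b; rewrite inE in ba.
case: (eqVneq p p') => [pp'|pp']; last first.
  by exists a, b, p, p'; split; split=> //; rewrite eq_sym.
subst p'.
have [q0 q0K q0p] : exists2 q, q \in K & q != p.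
  have /card_gt1P[u [v [uK vK uv]]] := K_ge2.
  by case: (eqVneq u p) => [up|]; [exists v; rewrite // -up eq_sym | exists u].
have [q [b' [qKp b'Kp b'p qb']]] : exists u v,
    [/\ u \in K :\ p, v \notin K :\ p, v \notin [set p] & e u v].
  have dis : [disjoint K :\ p & [set p]] by rewrite disjoint_sym disjoints1 in_setD1 eqxx.
  apply: (cn0 (K :\ p) [set p] _ dis q0 v0); rewrite ?cards1 ?in_setD1 ?q0p ?negb_and ?cK ?orbT //.
  by rewrite in_set1; apply: contraTneq v0c => ->; apply: Kc.
move: qKp b'Kp; rewrite inE in b'p; rewrite !in_setD1 b'p /= => /andP[qp qK] b'K.
have b'S := toS _ _ qK b'K qb'.
case: (eqVneq b' a) => [b'a|b'a].
  by exists b, b', p, q; split; split=> //; [rewrite b'a | rewrite eq_sym].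
by exists a, b', p, q; split; split=> //; rewrite eq_sym.
Qed.

(** On the arc from [next c a] to [b], [cross_detour] with at least two inner vertices supplies the
    shift conditions of [half_sum]. The arc is an abstract [t] so that the complementary arc,
    written with [drop], can be substituted too. *)
Let half_count c' a b k : lcyc c' -> c' =i c -> next c' =1 next c -> nth x1 c' L.-1 = a ->
  a \in S -> b \in S -> a != b -> detour k a b -> 1 < size k ->
  forall t, t = take (index b c').+1 c' ->
  count (e (next c a)) t + count (e (next c b)) t + count (mem S) t <= size t + 1.
Proof.
move=> lc' c'c n'n c'a aS bS ab dk k1; set ib := index b c' => t tE.
have uc' := lcycle_uniq lc'; have sc' := lcycle_size lc'.
have L0 : 0 < L by arith.
have := next_nth_last x1 uc'; rewrite sc' c'a n'n => /(_ L0) na.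
have bc' : b \in c' by rewrite c'c Sc.
have c'b : nth x1 c' ib = b by rewrite nth_index.
have iL : ib < L by rewrite -sc' index_mem.
have iL1 : ib.+1 < L.
  have : ib != L.-1 by apply: contraNneq ab => il; rewrite -c'a -c'b il.
  by arith.
have nn i : i.+1 < L -> next c (nth x1 c' i) = nth x1 c' i.+1.
  by move=> ilt; rewrite -n'n next_nth_lt // sc'.
have nb := nn ib iL1; rewrite c'b in nb.
have st : size t = ib.+1 by rewrite tE size_takel // sc'.
have cnt (p : pred T) : count p t = \sum_(0 <= i < ib.+1) p (nth x1 c' i).
  rewrite (count_nat_sum x1) st big_nat [RHS]big_nat; apply: eq_bigr => i /andP[_ ilt].
  by rewrite tE nth_take.
rewrite !cnt st addn1; have [_ _ kl] := detourP _ _ _ dk.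
have dj : disj c' k.
  by apply: disj_outside => // [|z zk]; [case/detourP: dk | rewrite c'c (detour_out dk)].
have inj i j : i < L -> j < L -> nth x1 c' i = nth x1 c' j -> i = j.
  by move=> il jl /eqP; rewrite nth_uniq ?sc' // => /eqP.
have cross i i' : i < i' <= ib -> e (next c b) (nth x1 c' i) ->
    e (next c a) (nth x1 c' i') -> size k + i.+1 <= i'.
  move=> ii' ei ei'; apply: (cross_detour (x0 := x1) e_sym L_max lc' dj ii' iL1).
  - by rewrite c'a c'b.
  - by rewrite -nb e_sym.
  - by rewrite -na e_sym.
apply: (@half_sum (fun i => e (next c a) (nth x1 c' i)) (fun i => e (next c b) (nth x1 c' i))
  (fun i => nth x1 c' i \in S)).
- by rewrite -na e_irr.
- by rewrite c'b.
- move=> i ilt; apply/negP => /andP[/(cross i i.+1) + ei'].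
  have ii : i < i.+1 <= ib by arith.
  by move=> /(_ ii ei'); arith.
- move=> i ilt; apply/negP => /andP[/(cross i i.+2) + ei'].
  have ii : i < i.+2 <= ib by arith.
  by move=> /(_ ii ei'); arith.
- move=> i ilt; have il : i.+1 < L by arith.
  apply/negP => /andP[iS]; apply/negP; rewrite -nn //; apply: S_next_nonadj => //.
  rewrite -c'a; apply/eqP => /inj; arith.
- move=> i ilt; have il : i.+1 < L by arith.
  apply/negP => /andP[iS]; apply/negP; rewrite -nn //; apply: S_next_nonadj => //.
  rewrite -c'b; apply/eqP => /inj; arith.
move=> i ilt; have il : i.+1 < L by arith.
by apply/negP => /andP[/S_next/negP]; rewrite nn.
Qed.

Let card_S_count : count (mem S) c = sg.
Proof.
rewrite -size_filter -(card_uniqP (filter_uniq _ uc)); apply: eq_card => x.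
by rewrite mem_filter andb_idr //; apply: Sc.
Qed.

Let split_degree x : x \in c -> x \notin S -> #|N x| = count (e x) c + #|N x :&: H'|.
Proof.
move=> xc xS; rewrite -(cardsID H' (N x)) addnC; congr (_ + _).
rewrite -size_filter -(card_uniqP (filter_uniq _ uc)); apply: eq_card => y.
have -> : (y \in N x :\: H') = ((y \in c) || (y \in K)) && e x y.
  by rewrite in_setD !in_set negb_and !negbK.
rewrite mem_filter /= andbC; case xy: (e x y) => //=.
case yc : (y \in c) => //=; apply/negbTE.
by apply: contra xS => yK; apply/SP; split=> //; exists y; rewrite // e_sym.
Qed.

(* The successors of [a] and [b] have no common neighbour outside the cycle, and on
   the cycle their neighbourhoods, one of them shifted, are disjoint and miss a
   vertex for every further attachment of the component. *)
Let main_inequality : 2 * d + m + sg <= #|T| + 2.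
Proof.
have [a [b [p [q [[aS bS ab] [pK qK pq pa qb]]]]]] := reps.
have [k [dk k0 /(_ pq) k1]] := detour_ex pK qK pa qb.
have [c' [lc' c'c n'n c'a]] := rotate_last x1 lc (Sc aS).
have uc' := lcycle_uniq lc'; have sc' := lcycle_size lc'.
set ib := index b c'.
have h1 := half_count lc' c'c n'n c'a aS bS ab dk k1 (erefl (take ib.+1 c')).
have bc' : b \in c' by rewrite c'c Sc.
have ac' : a \in c' by rewrite c'c Sc.
have iL : ib < size c' by rewrite index_mem.
have L0 : 0 < size c' by arith.
have c'b : nth x1 c' ib = b by rewrite nth_index.
have iL1 : ib.+1 < size c'.
  have : ib != (size c').-1 by apply: contraNneq ab => il; rewrite -c'a -c'b il sc'.
  by arith.
(* Rotating [b] to the last position exchanges the roles of [a] and [b] and gives the count on the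
   other arc. *)
set c2 := rot ib.+1 c'.
have lc2 : lcyc c2.
  by rewrite /lcycle rot_uniq uc' rot_cycle (lcycle_cycle lc') size_rot sc' /=.
have c2c : c2 =i c by move=> z; rewrite mem_rot c'c.
have n2n : next c2 =1 next c by move=> z; rewrite next_rot.
have ds : size (drop ib.+1 c') = size c' - ib.+1 by rewrite size_drop.
have c2b : nth x1 c2 L.-1 = b.
  rewrite /c2 /rot nth_cat ds -sc' ifN; last by arith.
  by rewrite nth_take; [rewrite (_ : _ - _ = ib) //|]; arith.
have c2a : index a c2 = (size c' - ib.+1).-1.
  have <- : nth x1 c2 (size c' - ib.+1).-1 = a.
    rewrite /c2 /rot nth_cat ds ifT; last by arith.
    by rewrite nth_drop (_ : _ + _ = L.-1) // -sc'; arith.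
  by rewrite index_uniq ?size_rot ?rot_uniq //; arith.
have ba : b != a by rewrite eq_sym.
have k1r : 1 < size (rev k) by rewrite size_rev.
have dE : drop ib.+1 c' = take (index a c2).+1 c2.
  by rewrite c2a prednK /c2 /rot ?take_size_cat //; arith.
have h2 := half_count lc2 c2c n2n c2b bS aS ba (detour_rev dk) k1r dE.
have cD (P : pred T) : count P c = count P (take ib.+1 c') + count P (drop ib.+1 c').
  rewrite -count_cat cat_take_drop.
  by apply/permP/uniq_perm => // z; rewrite c'c.
have uS := S_next aS; have wS := S_next bS.
have ucc : next c a \in c by rewrite mem_next Sc.
have wcc : next c b \in c by rewrite mem_next Sc.
have dis : [disjoint N (next c a) :&: H' & N (next c b) :&: H'].
  apply/pred0P => z; apply/negP => /andP[/=]; rewrite !in_setI !in_set.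
  move=> /andP[uz /andP[zc zK]] /andP[wz _].
  have := @no_cross _ e L e_sym L_max c (rev k) [:: z] a b lc (Sc aS) (Sc bS) ab.
  rewrite link1 (e_sym z) uz wz; case/detourP: (detour_rev dk) => ur kK -> H.
  have : ~~ true; last by []. apply: H => //.
  - rewrite cat_uniq ur /= ?orbF andbT; apply: contra zK => /kK.
    by rewrite inE.
  - move=> y; rewrite mem_cat inE => /orP[|/eqP->//]; exact: detour_out (detour_rev dk) y.
  - by rewrite size_cat addn1.
have cH : #|N (next c a) :&: H'| + #|N (next c b) :&: H'| <= #|H'|.
  rewrite -cardsUI (disjoint_setI0 dis) cards0 addn0 subset_leq_card //.
  by rewrite subUset !subsetIr.
have du := deg_ge (next c a); have dw := deg_ge (next c b).
rewrite (split_degree ucc uS) in du; rewrite (split_degree wcc wS) in dw.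
have st : size (take ib.+1 c') + size (drop ib.+1 c') = L.
  by rewrite -size_cat cat_take_drop.
move: du dw h1 h2; rewrite card_T -card_S_count !cD.
by move: cH st; arith.
Qed.

Let sg_ge2 : 2 <= sg.
Proof. by have [a [b [_ [_ [[aS bS ab] _]]]]] := reps; apply/card_gt1P; exists a, b. Qed.

Let KS_disjoint x : x \in K -> x \notin S.
Proof. by move=> /Kc; apply: contra => /Sc. Qed.

Let card_KS : #|K :|: S| = m + sg.
Proof.
rewrite cardsU (_ : K :&: S = set0) ?cards0 ?subn0 //; apply/setP => x; rewrite in_setI in_set0.
by apply/negP => /andP[/KS_disjoint/negPf->].
Qed.

Let nbr_KS x y : x \in K -> e x y -> y \in K :|: S.
Proof.
move=> xK xy; rewrite in_setU; case yc : (y \in c).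
  by apply/orP; right; apply/SP; split=> //; exists x.
by rewrite (Kclosed xK _ xy) ?yc.
Qed.

(** All neighbours of [x] lie in [K :|: S], which besides these contains [x] itself and all of
    [A]. *)
Let missed_set x (A : {set T}) : x \in K -> x \notin A -> A \subset K :|: S ->
  {in A, forall y, ~~ e x y} -> #|A| + d < m + sg.
Proof.
move=> xK xA AKS miss; rewrite -card_KS (cardsD1 x (K :|: S)) in_setU xK add1n ltnS.
apply: leq_trans (_ : #|A| + #|N x| <= _); first by rewrite leq_add2l.
have dis : [disjoint A & N x].
  by apply/pred0P => y; apply/negP => /andP[/= /miss xy]; rewrite in_set (negPf xy).
rewrite -cardsUI (disjoint_setI0 dis) cards0 addn0 subset_leq_card //.
apply/subsetP => y; rewrite in_setU in_setD1 => /orP[yA|].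
  by rewrite (subsetP AKS) // andbT; apply: contraNneq xA => <-.
rewrite in_set => xy; rewrite (nbr_KS xK xy) andbT.
by apply: contraTneq xy => ->; rewrite e_irr.
Qed.

Let missed_count x l : x \in K -> uniq l -> x \notin l -> {subset l <= K :|: S} ->
  count (fun v => ~~ e x v) l + d < m + sg.
Proof.
move=> xK ul xl lKS; rewrite -size_filter -(card_uniqP (filter_uniq _ ul)) -cardsE.
apply: (missed_set xK); first by rewrite in_set mem_filter negb_and xl orbT.
  by apply/subsetP => y; rewrite in_set mem_filter => /andP[_ /lKS].
by move=> y; rewrite in_set mem_filter => /andP[].
Qed.

Let KS_gt : d < m + sg.
Proof. by have := @missed_count x1 [::] (component_self _ _ _); apply. Qed.

Let KS_le : m + sg <= d + 3.
Proof. by move: main_inequality card_le; arith. Qed.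

Let detour_size k s s' : detour k s s' -> size k <= m.
Proof.
case/detourP => u kK _; rewrite -(card_uniqP u).
exact/subset_leq_card/subsetP.
Qed.

Let detour_max s s' k0 : detour k0 s s' -> exists k, [/\ detour k s s',
  size k0 <= size k & forall k', detour k' s s' -> size k' <= size k].
Proof.
move=> dk0; pose P j := [exists t : j.-tuple T, detour t s s'].
have Pof k : detour k s s' -> P (size k).
  by move=> dk; apply/existsP; exists (in_tuple k).
have exP : exists j, P j by exists (size k0); apply: Pof.
have ubP j : P j -> j <= m by move=> /existsP[t /detour_size]; rewrite size_tuple.
case: (ex_maxnP exP ubP) => j /existsP[t dt] jmax.
by exists t; rewrite size_tuple; split=> // [|k' /Pof]; apply: jmax => //; apply: Pof.
Qed.

Let inner_uniq k s s' : s \in S -> s' \in S -> s != s' -> detour k s s' ->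
  uniq (s :: rcons k s') /\ {subset s :: rcons k s' <= K :|: S}.
Proof.
move=> sS s'S ss' /detourP[u kK _]; have nk t : t \in S -> t \notin k.
  by move=> tS; apply: contraL tS => /kK/KS_disjoint.
split; first by rewrite /= mem_rcons inE negb_or ss' nk // rcons_uniq nk.
move=> z; rewrite in_cons mem_rcons in_cons in_setU => /or3P[/eqP->|/eqP->|/kK ->//].
  by rewrite sS orbT.
by rewrite s'S orbT.
Qed.

(** A vertex of [K] adjacent to two consecutive vertices could be inserted into the longest
    detour. *)
Let detour_sparse k s s' y : detour k s s' ->
  (forall k', detour k' s s' -> size k' <= size k) -> y \in K -> y \notin k ->
  path (fun u v => ~~ (e y u && e y v)) s (rcons k s').
Proof.
case/detourP => u kK l kmax yK yk; apply: negbNE; apply/negP.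
move=> /(insert_link e_sym l)[k' lk' pk'].
have /kmax : detour k' s s'.
  apply/detourP; split=> //; first by rewrite (perm_uniq pk') /= yk.
  by move=> z; rewrite (perm_mem pk') inE => /orP[/eqP-> //|/kK].
by rewrite (perm_size pk') /= ltnn.
Qed.

Let detour_full_or k s s' : detour k s s' -> size k < m -> exists2 y, y \in K & y \notin k.
Proof.
case/detourP => u kK _ km; have : 0 < #|K :\: [set x in k]|.
  have ck : #|[set x in k]| = size k by rewrite cardsE; apply/card_uniqP.
  have sub : [set x in k] \subset K by apply/subsetP => z; rewrite in_set; apply: kK.
  by rewrite cardsD (setIidPr sub) ck subn_gt0.
by case/card_gt0P => y; rewrite in_setD in_set => /andP[]; exists y.
Qed.

Let K_exit (A : pred T) x y : x \in K -> y \in K -> A x -> ~~ A y ->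
  exists u v, [/\ u \in K, v \in K, A u, ~~ A v & e u v].
Proof.
move=> xK yK Ax; have [p [xp <- _]] := component_path e_sym x1c xK yK.
elim: p x xp {xK yK} Ax => [|z p IH] x /= => [_ -> //|/andP[xz zp] Ax sub Ay].
have zK : z \in K by apply: sub; rewrite !inE eqxx orbT.
case: (boolP (A z)) => Az; last first.
  by exists x, z; split=> //; apply: sub; rewrite mem_head.
by apply: (IH z) => // w wp; apply: sub; rewrite inE wp orbT.
Qed.

(** A detour can replace either of the two arcs between a pair of attachments, so each arc has at
    least [D] inner vertices. *)
Let gap_index (S' : {set T}) D c' i j : S' \subset S ->
  {in S' &, forall s s', s != s' -> exists2 k, detour k s s' & D <= size k} ->
  lcyc c' -> c' =i c -> i < j < L -> nth x1 c' i \in S' -> nth x1 c' j \in S' ->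
  D < j - i /\ D < L - j + i.
Proof.
move=> S'S det lc' c'c /andP[ij jL] iS jS.
have uc' := lcycle_uniq lc'; have sc' := lcycle_size lc'.
have lr n : lcyc (rot n c').
  by rewrite /lcycle rot_uniq uc' rot_cycle (lcycle_cycle lc') size_rot sc' /=.
have neq : nth x1 c' i != nth x1 c' j by rewrite nth_uniq ?sc' //; arith.
have aux a b t : a < L -> t < L -> nth x1 (rot a.+1 c') t = nth x1 c' b ->
    nth x1 c' a \in S' -> nth x1 c' b \in S' -> nth x1 c' a != nth x1 c' b -> D <= t.
  move=> aL tL tb aS bS ab; have [k dk Dk] := det _ _ aS bS ab.
  apply: leq_trans Dk _; case/detourP: (dk) => u kK l.
  apply: (shortcut (x0 := x1) L_max (lr a.+1) _ tL).
    apply: disj_outside; rewrite ?rot_uniq // => z /(detour_out dk).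
    by rewrite mem_rot c'c.
  rewrite tb nth_rot sc'; try arith.
  suff -> : (if L.-1 < L - a.+1 then a.+1 + L.-1 else L.-1 - (L - a.+1)) = a by [].
  by case: ifP; arith.
split.
  have := aux i j (j - i.+1); rewrite nth_rot sc'; try arith.
  rewrite ifT; last by arith.
  rewrite (_ : i.+1 + (j - i.+1) = j); last by arith.
  have t1 : i < L by arith.
  have t2 : j - i.+1 < L by arith.
  by move=> /(_ t1 t2 erefl iS jS neq); arith.
have := aux j i (L - j.+1 + i); rewrite nth_rot sc'; try arith.
rewrite ifF; last by arith.
rewrite (_ : L - j.+1 + i - (L - j.+1) = i); last by arith.
have t2 : L - j.+1 + i < L by arith.
by rewrite eq_sym in neq; move=> /(_ jL t2 erefl jS iS neq); arith.
Qed.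

Let spaced_count (S' : {set T}) D : S' \subset S -> 1 < #|S'| ->
  {in S' &, forall s s', s != s' -> exists2 k, detour k s s' & D <= size k} ->
  D.+1 * #|S'| <= L.
Proof.
move=> S'S S'1 det; have [s0 [s1 [s0S s1S s01]]] := card_gt1P S'1.
have S'c s : s \in S' -> s \in c by move=> /(subsetP S'S)/Sc.
have [c' [lc' c'c n'n c'0]] := rotate_first x1 lc (S'c _ s0S).
have uc' := lcycle_uniq lc'; have sc' := lcycle_size lc'.
have L0 : 0 < L by arith.
(* Position [0] is repeated as position [L], so that [spaced_sum] over [L + 1] places also accounts
   for the gap that closes the cycle. *)
pose F i := nth x1 c' (if i == L then 0 else i) \in S'.
have FL : F L by rewrite /F eqxx c'0.
have F0 : F 0 by rewrite /F; case: ifP => _; rewrite c'0.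
have Fi i : i < L -> F i = (nth x1 c' i \in S') by move=> iL; rewrite /F ltn_eqF.
have sp i j : i < j < L.+1 -> F i -> F j -> i + D < j.
  move=> /andP[ij]; rewrite ltnS leq_eqVlt => /orP[/eqP jL|jL].
    subst j => iS _; case: (posnP i) => [->|i0].
      have jc : s1 \in c' by rewrite c'c S'c.
      have jL : index s1 c' < L by rewrite -sc' index_mem.
      have j0 : 0 < index s1 c'.
        rewrite lt0n; apply: contra s01 => /eqP j0.
        by rewrite -c'0 -{1}j0 nth_index.
      have ij0 : 0 < index s1 c' < L by rewrite j0 jL.
      have := gap_index S'S det lc' c'c ij0; rewrite c'0 nth_index //.
      by move=> /(_ s0S s1S) []; arith.
    have ij0 : 0 < i < L by rewrite i0.
    have := gap_index S'S det lc' c'c ij0; rewrite c'0 -Fi //.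
    by move=> /(_ s0S iS) []; arith.
  have iL : i < L by arith.
  have ijL : i < j < L by rewrite ij.
  rewrite !Fi // => iS jS; have [] := gap_index S'S det lc' c'c ijL iS jS.
  by arith.
have := spaced_sum sp; rewrite big_nat_recr //= FL.
suff -> : \sum_(0 <= i < L) F i = #|S'| by rewrite mulnDr muln1; arith.
transitivity (\sum_(0 <= i < L) (nth x1 c' i \in S')).
  by rewrite big_nat [RHS]big_nat; apply: eq_bigr => i /andP[_ /Fi->].
rewrite -sc' -(count_nat_sum x1 (mem S')) -size_filter -(card_uniqP (filter_uniq _ uc')).
by apply: eq_card => x; rewrite mem_filter c'c andb_idr //; apply: S'c.
Qed.

Let K_nbr p : p \in K -> exists y, [/\ y \in K, y != p & e p y].
Proof.
move=> pK; have [q qK qp] : exists2 q, q \in K & q != p.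
  have /card_gt1P[u [v [uK vK uv]]] := K_ge2.
  by case: (eqVneq u p) => [up|]; [exists v; rewrite // -up eq_sym | exists u].
have [u [v [_ vK /= /eqP-> vp pv]]] := @K_exit (pred1 p) p q pK qK (eqxx p) qp.
by exists v.
Qed.

Let sparse_size k s s' y : s \in S -> s' \in S -> s != s' -> detour k s s' ->
  (forall k', detour k' s s' -> size k' <= size k) -> y \in K -> y \notin k ->
  size k < 2 * count (fun v => ~~ e y v) (s :: rcons k s').
Proof.
move=> sS s'S ss' dk kmax yK yk.
have := sparse_path (detour_sparse dk kmax yK yk); rewrite size_rcons.
exact: leq_trans (leq_addr _ _).
Qed.

Let notin_inner k s s' y : s \in S -> s' \in S -> y \in K -> y \notin k ->
  y \notin s :: rcons k s'.
Proof.
move=> sS s'S yK yk; rewrite inE mem_rcons inE !negb_or yk andbT.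
by rewrite !(contraTneq _ (KS_disjoint yK)) // => ->; rewrite ?sS ?s'S.
Qed.

(** A vertex of [K] off a longest detour misses at most one vertex of it, so by sparsity the detour
    has a single inner vertex [q]. A neighbour of [q] in [K] would then miss both [s] and [s']. *)
Let full_detour : m + sg <= d + 2 ->
  {in S &, forall s s', s != s' -> exists2 k, detour k s s' & m <= size k}.
Proof.
move=> e1 s s' sS s'S ss'; have [k0 dk0 k00] := detour_S sS s'S.
have [k [dk k0k kmax]] := detour_max dk0; exists k => //.
rewrite leqNgt; apply/negP => km; have [y yK yk] := detour_full_or dk km.
have [ul lKS] := inner_uniq sS s'S ss' dk.
have few w : w \in K -> w \notin k -> count (fun v => ~~ e w v) (s :: rcons k s') <= 1.
  move=> wK wk; have := missed_count wK ul (notin_inner sS s'S wK wk) lKS.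
  by move: (count _ _) => p; arith.
have := sparse_size sS s'S ss' dk kmax yK yk.
have := few y yK yk; move: (count _ _) => p p1 kp.
have k1 : size k = 1 by arith.
case: k dk kmax k1 few {km k0k y yK yk ul lKS p p1 kp} => [|q [|//]] // dk kmax _ few.
have qK : q \in K by case/detourP: dk => _ qK _; apply: qK; rewrite mem_head.
have [y [yK yq qy]] := K_nbr qK.
have yk : y \notin [:: q] by rewrite inE.
have := detour_sparse dk kmax yK yk; have := few y yK yk.
by rewrite /= (e_sym y q) qy andbT /=; case: (e y s); case: (e y s').
Qed.

(** Gaps of at least [m] vertices give [m.+1 * sg <= L]; with [m + sg = d + 2] this would mean
    [(m - 2) * (sg - 2) + 1 <= 0]. *)
Let tight_of_excess_le1 : m + sg <= d + 2 -> m + sg = d + 1 /\ m.+1 * sg <= L.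
Proof.
move=> e1; have spc := spaced_count (subxx S) sg_ge2 (full_detour e1); split=> //.
apply/eqP; rewrite eqn_leq; apply/andP; split; last by rewrite addn1; apply: KS_gt.
rewrite leqNgt; apply/negP => gt; have e2 : m + sg = d + 2 by arith.
have n1 : L + m <= 3 * d + 1.
  by apply: leq_trans card_le; rewrite card_T leq_addr.
have m2 := K_ge2; have s2 := sg_ge2; move: spc n1 m2 s2; rewrite -/sg.
have -> : d = m + sg - 2 by arith.
move: m sg e2 => a b e2 spc n1 m2 s2.
have [p ap] : exists p, a = p + 2 by exists (a - 2); arith.
have [q bq] : exists q, b = q + 2 by exists (b - 2); arith.
by subst a b; nia.
Qed.

(** Each of the two vertices of [K] misses at most two attachments, so their set [F] of common
    neighbours has at least [sg - 4 = d - 3 > 0] members. The disjoint sets [S], [S1] and [F2] force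
    [L >= 3 * d - 1], so [H'] is empty and any member of [F] is a center. *)
Let center_of_excess2 : m + sg = d + 3 -> m = 2 ->
  exists2 v, v \in c & forall x, x \notin c -> e v x.
Proof.
move=> e2 m2.
have x1K : x1 \in K by apply: component_self.
have y1K : y1 \in K by apply: Kclosed x1K y1c x1y1.
have xy1 : x1 != y1 by apply: contraTneq x1y1 => ->; rewrite e_irr.
have KE : K = [set x1; y1].
  apply/esym/eqP; rewrite eqEcard subUset !sub1set x1K y1K /= -/m m2 cards2.
  by rewrite xy1.
have mis x : x \in K -> #|S :\: N x| <= 2.
  move=> xK; have : #|S :\: N x| + d < m + sg.
    apply: (missed_set xK); first by rewrite in_setD negb_and (KS_disjoint xK) orbT.
      by apply: subset_trans (subsetDl _ _) (subsetUr _ _).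
    by move=> y; rewrite in_setD in_set => /andP[].
  by rewrite e2; arith.
pose F := S :&: N x1 :&: N y1.
have FS f : f \in F -> f \in S by rewrite !in_setI => /andP[/andP[]].
have cF : sg <= #|F| + 4.
  have : #|S| <= #|F :|: ((S :\: N x1) :|: (S :\: N y1))|.
    apply/subset_leq_card/subsetP => s sS; rewrite !in_setU !in_setD !in_setI sS /= !andbT.
    by case: (s \in N x1); case: (s \in N y1).
  move=> H; apply: leq_trans H _; apply: leq_trans (leq_card_setU _ _) _.
  rewrite leq_add2l; apply: leq_trans (leq_card_setU _ _) _.
  exact: leq_add (mis _ x1K) (mis _ y1K).
have ninj : injective (next c) := lcycle_inj lc.
pose S1 := next c @: S; pose F2 := [set next c (next c f) | f in F].
have cF2 : #|F2| = #|F| by apply: card_imset => u v /ninj/ninj.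
have d1 : [disjoint S & S1].
  apply/pred0P => u; apply/negP => /andP[/= uS /imsetP[s sS us]].
  by have := S_next sS; rewrite -us uS.
(* If [next c (next c f)] were an attachment, a detour with two inner vertices could replace the
   single vertex before it; [f] is adjacent to both vertices of [K], so distinct ends are
   available. *)
have d2 : [disjoint S :|: S1 & F2].
  apply/pred0P => u; apply/negP => /andP[/=]; rewrite in_setU => uSS /imsetP[f fF uE].
  case/orP: uSS => [uS|/imsetP[s sS us]]; last first.
    have /ninj sE : next c s = next c (next c f) by rewrite -us.
    by have := S_next (FS f fF); rewrite -sE sS.
  have fS := FS f fF; have [c' [lc' c'c n'n c'f]] := rotate_last x1 lc (Sc fS).
  have uc' := lcycle_uniq lc'; have sc' := lcycle_size lc'.
  have L0 : 0 < L by arith.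
  have := next_nth_last x1 uc'; rewrite sc' c'f n'n => /(_ L0) nf.
  have := @next_nth_lt _ x1 c' 0 uc'; rewrite sc' n'n -nf -uE => /(_ (ltnW L_ge3)) u1.
  have [t tK tu] : exists2 t, t \in K & e t u by case/SP: uS.
  have [p [pK pt pf]] : exists p, [/\ p \in K, p != t & e p f].
    move: fF; rewrite !in_setI !in_set => /andP[/andP[_ xf] yf].
    by case: (eqVneq x1 t) => [xt|]; [exists y1; rewrite -xt eq_sym | exists x1].
  have [k [dk _ /(_ pt) k1]] := detour_ex pK tK pf tu.
  case/detourP: (dk) => uk kK l.
  have dj : disj c' k.
    by apply: disj_outside => // w /(detour_out dk); rewrite c'c.
  have := shortcut (x0 := x1) L_max lc' dj (ltnW L_ge3); rewrite c'f -u1 => /(_ l).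
  by rewrite leqNgt k1.
have : #|S :|: S1 :|: F2| <= L.
  apply: (card_in_cycle lc) => u; rewrite !in_setU => /orP[/orP[/Sc //|/imsetP[s /Sc sc ->]]|].
    by rewrite mem_next.
  by case/imsetP => f /FS/Sc fc ->; rewrite !mem_next.
rewrite cardsU (disjoint_setI0 d2) cards0 subn0 cardsU (disjoint_setI0 d1) cards0 subn0.
rewrite card_imset // cF2 -/sg => bnd.
have cT := card_T; have cl := card_le.
have h0 : #|H'| = 0 by move: bnd cT cl cF e2; rewrite m2; move: (#|F|); arith.
have /card_gt0P[v vF] : 0 < #|F| by move: cF e2 d_ge4; rewrite m2; move: (#|F|); arith.
exists v; first exact/Sc/FS.
move=> x xc; have xK : x \in K.
  apply: contraT => xK; have : x \in H' by rewrite in_set xc xK.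
  by rewrite (cards0_eq h0) in_set0.
move: vF xK; rewrite KE !in_setI in_set2 !in_set => /andP[/andP[_ xv] yv].
by move=> /orP[]/eqP->; rewrite e_sym.
Qed.

Let two_outside k s s' : detour k s s' -> size k + 1 < m ->
  exists y z, [/\ y \in K, z \in K, y \notin k, z \notin k & y != z].
Proof.
move=> dk km; have [u kK _] := detourP _ _ _ dk.
have : 1 < #|K :\: [set x in k]|.
  have ck : #|[set x in k]| = size k by rewrite cardsE; apply/card_uniqP.
  have sub : [set x in k] \subset K by apply/subsetP => z; rewrite in_set; apply: kK.
  by rewrite cardsD (setIidPr sub) ck ltn_subRL.
case/card_gt1P => y [z [+ + yz]]; rewrite !in_setD !in_set.
by move=> /andP[yk yK] /andP[zk zK]; exists y, z; split; rewrite // inE.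
Qed.

(** Suppose a longest detour omits two vertices. Each omitted vertex misses exactly two vertices of
    [l], so omitted vertices are pairwise adjacent, and sparsity leaves two or three inner vertices.
    In both cases a longer detour through two omitted vertices exists. *)
Let long_detour s s' p q : m + sg = d + 3 -> s \in S -> s' \in S -> s != s' ->
  p \in K -> q \in K -> p != q -> e p s -> e q s' ->
  exists2 k, detour k s s' & m <= size k + 1.
Proof.
move=> e2 sS s'S ss' pK qK pq ps qs'.
have [k0 [dk0 _ /(_ pq) k02]] := detour_ex pK qK ps qs'.
have [k [dk k0k kmax]] := detour_max dk0; exists k => //.
rewrite leqNgt; apply/negP => km.
have [ul lKS] := inner_uniq sS s'S ss' dk; have [uk kK kl] := detourP _ _ _ dk.
set l := s :: rcons k s' in ul lKS.
have two w : w \in K -> w \notin k -> count (fun v => ~~ e w v) l <= 2.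
  move=> wK wk; have := missed_count wK ul (notin_inner sS s'S wK wk) lKS.
  by rewrite e2; move: (count _ _) => c1; arith.
have ge2 w : w \in K -> w \notin k -> 1 < count (fun v => ~~ e w v) l.
  move=> wK wk; have := sparse_size sS s'S ss' dk kmax wK wk; rewrite -/l.
  by move: (count _ _) k02 k0k => c1; arith.
have adj w w' : w \in K -> w \notin k -> w' \in K -> w' \notin k -> w != w' -> e w w'.
  move=> wK wk w'K w'k ww'; apply: contraT => nww'.
  have w'l := notin_inner sS s'S w'K w'k; have wl := notin_inner sS s'S wK wk.
  have sub : {subset w' :: l <= K :|: S}.
    by move=> z; rewrite in_cons => /orP[/eqP->|/lKS //]; rewrite in_setU w'K.
  have := @missed_count w (w' :: l) wK.
  rewrite cons_uniq w'l ul in_cons negb_or ww' wl => /(_ isT isT sub).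
  rewrite -cat1s count_cat /= nww' e2; have := ge2 w wK wk; rewrite /l /=.
  by move: (count _ _) (~~ e w s : nat) => c1 c2; arith.
have [y [z [yK zK yk zk yz]]] := two_outside dk km.
have k3 : size k <= 3.
  have := sparse_size sS s'S ss' dk kmax yK yk; rewrite -/l; have := two y yK yk.
  by move: (count _ _) => c1; arith.
have k2 : 1 < size k by arith.
have TL k' : link e k' s s' -> uniq k' -> all (mem K) k' -> size k' <= size k.
  by move=> l' u' s''; apply: kmax; apply/and3P.
have sparse w : w \in K -> w \notin k -> path (fun u v => ~~ (e w u && e w v)) s (rcons k s').
  exact: detour_sparse dk kmax.
rewrite /l in two; clear ge2 kmax km k0k ul lKS dk l.
case: k k2 k3 sparse TL uk kK kl yk zk two adj
  => [|p1 [|p2 [|p3 [|//]]]] //= _ _ sparse TL uk kK kl yk zk two adj.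
  have p1K : p1 \in K by apply: kK; rewrite !inE eqxx.
  have p2K : p2 \in K by apply: kK; rewrite !inE eqxx orbT.
  (* The omitted [w] is adjacent to an inner vertex, and a second omitted [x] is adjacent to [w] and
     to [s] or [s']; going through both gives at least three inner vertices. *)
  have [u [w [_ wK uk' wk uw]]] := @K_exit (mem [:: p1; p2]) p1 y p1K yK (mem_head _ _) yk.
  have [x [xK xk wx]] : exists x, [/\ x \in K, x \notin [:: p1; p2] & w != x].
    case: (eqVneq w y) => [->|wy]; first by exists z; split.
    by exists y.
  have exw := adj w x wK wk xK xk wx.
  have exw' : e x w by rewrite e_sym.
  have xss : e x s || e x s'.
    have := sparse x xK xk; have := two x xK xk; rewrite /=.
    by case: (e x s); case: (e x s'); case: (e x p1); case: (e x p2).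
  move: kl; rewrite /link /= andbT => /and3P[sp1 p12 p2s'].
  have p12n : p1 != p2 by move: uk; rewrite /= inE andbT.
  move: wk xk uk'; rewrite [mem _ w]inE !inE !negb_or => /andP[wp1 wp2] /andP[xp1 xp2] uE.
  have [p1w p2w] : p1 != w /\ p2 != w by rewrite ![_ == w]eq_sym.
  have [p1x p2x] : p1 != x /\ p2 != x by rewrite ![_ == x]eq_sym.
  have xw : x != w by rewrite eq_sym.
  have wu : e w u by rewrite e_sym.
  case/orP: xss => [xs|xs']; case/orP: uE => /eqP uE; subst u.
  - have := TL [:: x; w; p1; p2].
    rewrite /link /= !in_cons !in_nil ?orbF !andbT !negb_or xK wK p1K p2K xw xp1 xp2 wp1 wp2 p12n.
    by rewrite (e_sym s) xs exw' wu p12 p2s' => /(_ isT isT isT).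
  - have := TL [:: x; w; p2].
    rewrite /link /= !in_cons !in_nil ?orbF !andbT !negb_or xK wK p2K xw xp2 wp2.
    by rewrite (e_sym s) xs exw' wu p2s' => /(_ isT isT isT).
  - have := TL [:: p1; w; x].
    rewrite /link /= !in_cons !in_nil ?orbF !andbT !negb_or xK wK p1K p1w p1x wx.
    by rewrite sp1 uw exw xs' => /(_ isT isT isT).
  - have := TL [:: p1; p2; w; x].
    rewrite /link /= !in_cons !in_nil ?orbF !andbT !negb_or xK wK p1K p2K p12n p1w p1x p2w p2x wx.
    by rewrite sp1 p12 uw exw xs' => /(_ isT isT isT).
have p2K : p2 \in K by apply: kK; rewrite !inE eqxx orbT.
have p3K : p3 \in K by apply: kK; rewrite !inE eqxx !orbT.
(* At least three of the five vertices [s], [p1], [p2], [p3], [s'] are neighbours of [w], no two of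
   them consecutive, hence the first, third and fifth. *)
have near w : w \in K -> w \notin [:: p1; p2; p3] -> e w s && e w p2.
  move=> wK wk; have := sparse w wK wk; have := two w wK wk; rewrite /=.
  by case: (e w s); case: (e w p1); case: (e w p2); case: (e w p3); case: (e w s').
have /andP[ys _] := near y yK yk; have /andP[_ zp2] := near z zK zk.
have eyz := adj y z yK yk zK zk yz.
move: kl uk yk zk; rewrite /link /= !in_cons !in_nil ?orbF !andbT !negb_or => /and4P[_ _ p23 p3s'].
move=> /andP[_ p23n] /and3P[_ yp2 yp3] /and3P[_ zp2n zp3].
have := TL [:: y; z; p2; p3].
rewrite /link /= !in_cons !in_nil ?orbF !andbT !negb_or yK zK p2K p3K yz yp2 yp3 zp2n zp3 p23n.
by rewrite (e_sym s) ys eyz zp2 p23 p3s' => /(_ isT isT isT).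
Qed.

(* Either any two attachments are joined by a detour missing at most one vertex of
   the component, or some two attachments [s], [s'] share their only neighbour [p]
   in it; in the second case the component is complete, and all attachments other
   than [s'] are joined by detours through the whole component. *)
Let excess2_absurd : m + sg = d + 3 -> 2 < m -> False.
Proof.
move=> e2 m3; have n1 : L + m <= 3 * d + 1.
  by apply: leq_trans card_le; rewrite card_T leq_addr.
have s2 := sg_ge2.
pose private s s' p := [forall y in K, (y != p) ==> ~~ e y s && ~~ e y s'].
have [/existsP[s /existsP[s' /existsP[p /and5P[sS s'S ss' pK /forall_inP prv]]]]|none] :=
  boolP [exists s, exists s', exists p,
    [&& s \in S, s' \in S, s != s', p \in K & private s s' p]]; last first.
  have det : {in S &, forall s s', s != s' -> exists2 k, detour k s s' & m.-1 <= size k}.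
    move=> s s' sS s'S ss'.
    have [/existsP[p /existsP[q /and5P[pK qK pq ps qs']]]|no] :=
      boolP [exists p, exists q, [&& p \in K, q \in K, p != q, e p s & e q s']].
      by have [k dk km] := long_detour e2 sS s'S ss' pK qK pq ps qs'; exists k => //; arith.
    have same p q : p \in K -> q \in K -> e p s -> e q s' -> p = q.
      move=> pK qK ps qs'; apply/eqP; apply: contraNT no => pq.
      by apply/existsP; exists p; apply/existsP; exists q; rewrite pK qK pq ps.
    have [_ [p pK ps]] := SP _ sS; have [_ [q qK qs']] := SP _ s'S.
    case/negP: none; apply/existsP; exists s; apply/existsP; exists s'; apply/existsP; exists p.
    rewrite sS s'S ss' pK /=; apply/forall_inP => y yK; apply/implyP => yp.
    apply/andP; split; apply: contra yp => ye; apply/eqP.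
      by rewrite (same y q) // (same p q).
    by rewrite (same p y).
  have := spaced_count (subxx S) sg_ge2 det; rewrite -/sg.
  have -> : m.-1.+1 = m by arith.
  move: n1 s2 m3; have -> : d = m + sg - 3 by arith.
  move: m sg => a b n1 s2 m3 sp.
  have [i ai] : exists i, a = i + 3 by exists (a - 3); arith.
  have [j bj] : exists j, b = j + 2 by exists (b - 2); arith.
  by subst a b; nia.
have prv' y : y \in K -> y != p -> ~~ e y s /\ ~~ e y s'.
  by move=> yK yp; have := prv y yK; rewrite yp => /andP.
(* Only two vertices can be missed, and [s] and [s'] already are. *)
have adj y v : y \in K -> y != p -> v \in K :|: S -> v != y -> v != s -> v != s' -> e y v.
  move=> yK yp vKS vy vs vs'; apply: contraT => yv; have [ys ys'] := prv' y yK yp.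
  have : #|[set v; s; s']| + d < m + sg.
    apply: (missed_set yK).
    - rewrite !in_setU !in_set1 !negb_or (eq_sym y) vy /=.
      by rewrite !(contraTneq _ (KS_disjoint yK)) // => ->; rewrite ?sS ?s'S.
    - apply/subsetP => w; rewrite [w \in [set v; s; s']]in_setU in_set2 in_set1 -orbA.
      by case/or3P => /eqP->; rewrite // in_setU ?sS ?s'S orbT.
    - by move=> w; rewrite !in_setU !in_set1 -orbA => /or3P[]/eqP->.
  by rewrite -setUA cardsU1 cards2 in_set2 ss' negb_or vs vs' e2; arith.
have Kne v : v \in K -> v != s /\ v != s'.
  by move=> vK; split; apply: contraTneq (KS_disjoint vK) => ->; rewrite ?sS ?s'S.
have clique y v : y \in K -> v \in K -> y != v -> e y v.
  move=> yK vK yv; have [ys ys'] := Kne y yK; have [vs vs'] := Kne v vK.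
  case: (eqVneq y p) => [yp|yp].
    by rewrite e_sym adj // ?in_setU ?yK // -yp eq_sym.
  by rewrite adj // ?in_setU ?vK // eq_sym.
(* An attachment with a neighbour other than [p] is a third one, so at least two remain when [s'] is
   removed. *)
have [b [q [bS qK qp qb]]] : exists b q, [/\ b \in S, q \in K, q != p & e q b].
  have [a [b [p' [q [[aS bS _] [p'K qK pq pa qb]]]]]] := reps.
  case: (eqVneq q p) => [qp|qp]; last by exists b, q.
  by exists a, p'; split; rewrite // -qp.
have [qs qs'] := prv' q qK qp.
have bs : b != s by apply: contraTneq qb => ->.
have bs' : b != s' by apply: contraTneq qb => ->.
have cS' : #|S :\ s'| = sg.-1 by rewrite /sg (cardsD1 s' S) s'S.
have s3 : 2 < sg.
  rewrite /sg -(cardsID [set s; s'] S) (_ : S :&: _ = [set s; s']).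
    by rewrite cards2 ss' -[2]addn0 ltn_add2l; apply/card_gt0P; exists b;
      rewrite in_setD in_set2 negb_or bs bs'.
  by apply/setIidPr; rewrite subUset !sub1set sS s'S.
have det : {in S :\ s' &, forall t t', t != t' -> exists2 k, detour k t t' & m <= size k}.
  move=> t t'; rewrite !in_setD1 => /andP[ts' tS] /andP[t's' t'S] tt'.
  have [k0 dk0 k00] := detour_S tS t'S; have [k [dk k0k kmax]] := detour_max dk0.
  exists k => //; rewrite leqNgt; apply/negP => km.
  have [uk kK kl] := detourP _ _ _ dk.
  have sparse w : w \in K -> w \notin k -> path (fun u v => ~~ (e w u && e w v)) t (rcons k t').
    exact: detour_sparse dk kmax.
  have [y yK yk] := detour_full_or dk km.
  case: k sparse uk kK yk km k0k {dk kl kmax} => [|k1 [|k2 k]] sparse uk kK yk km k0k.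
  - by move: k0k; rewrite /= leqNgt k00.
  - have dk1 : size [:: k1] + 1 < m by rewrite /=; arith.
    have k1K : k1 \in K by apply: kK; rewrite mem_head.
    (* Neither [t] nor [t'] is [s'] and one of them is not [s], so [w] is adjacent to that one and
       to [k1] and could be inserted. *)
    have [w [wK wp wk1]] : exists w, [/\ w \in K, w != p & w != k1].
      have : 0 < #|K :\ p :\ k1|.
        have := cardsD1 p K; have := cardsD1 k1 (K :\ p); rewrite -/m.
        by move: (#|K :\ p|) (#|_ :\ k1|) => i j; move: (k1 \in _) (p \in K); arith.
      by case/card_gt0P => w; rewrite !in_setD1 => /and3P[w1 w2 w3]; exists w.
    have wk : w \notin [:: k1] by rewrite mem_seq1.
    have := sparse w wK wk; rewrite /= (clique w k1) //.
    case: (eqVneq t s) => [ts|ts].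
      have t's : t' != s by rewrite -ts eq_sym.
      rewrite (adj w t') ?andbF // ?in_setU ?t'S ?orbT //.
      by apply: contraTneq t'S => ->; apply: KS_disjoint.
    rewrite (adj w t) ?andbF // ?in_setU ?tS ?orbT //.
    by apply: contraTneq tS => ->; apply: KS_disjoint.
  - move: yk; rewrite !in_cons !negb_or => /and3P[yk1 yk2 yk].
    have k1K : k1 \in K by apply: kK; rewrite mem_head.
    have k2K : k2 \in K by apply: kK; rewrite in_cons mem_head orbT.
    have yk' : y \notin [:: k1, k2 & k] by rewrite !in_cons !negb_or yk1 yk2.
    by have := sparse y yK yk'; rewrite /= (clique y k1) // (clique y k2) ?andbF.
have S'1 : 1 < #|S :\ s'| by rewrite cS'; arith.
have := spaced_count (subD1set S s') S'1 det; rewrite cS'.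
move: n1 s3 m3; have -> : d = m + sg - 3 by arith.
move: m sg => a b' n1 s3 m3 sp.
have [i ai] : exists i, a = i + 3 by exists (a - 3); arith.
have [j bj] : exists j, b' = j + 3 by exists (b' - 3); arith.
have jj : (j + 3).-1 = j + 2 by arith.
subst a b'; rewrite jj in sp.
have exp : (i + 3).+1 * (j + 2) = i * j + 2 * i + 4 * j + 8 by clear; lia.
by move: sp n1; rewrite exp; move: (i * j) => ij; clear; lia.
Qed.

(** * The tight case: a complete component joined to all its attachments *)

Section Tight.

Hypothesis tight : m + sg = d + 1.
Hypothesis long : m.+1 * sg <= L.

Let det : {in S &, forall s s', s != s' -> exists2 k, detour k s s' & m <= size k}.
Proof. by apply: full_detour; rewrite tight; arith. Qed.

Let join x y : x \in K -> y \in K :|: S -> x != y -> e x y.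
Proof.
move=> xK yKS xy; apply: contraT => nxy; have := @missed_count x [:: y] xK.
rewrite mem_seq1 /= nxy tight => /(_ isT xy) H.
have : {subset [:: y] <= K :|: S} by move=> z; rewrite mem_seq1 => /eqP->.
by move=> /H; arith.
Qed.

(** Together with [prod_ge], which is [(m - 2) * (sg - 2) >= 0], this leaves at most two vertices in
    [H']. *)
Let budget : m * sg + #|H'| + 2 <= 2 * (m + sg).
Proof.
have := card_le; rewrite card_T; have -> : d = m + sg - 1 by rewrite tight; arith.
have := K_ge2; move: sg_ge2 long; rewrite mulSn -/m; move: (m * sg) => p; arith.
Qed.

Let prod_ge : 2 * m + 2 * sg <= m * sg + 4.
Proof.
have := sg_ge2; have := K_ge2; rewrite -/m; move: m sg => a b a2 b2.
have [i ai] : exists i, a = i + 2 by exists (a - 2); arith.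
have [j bj] : exists j, b = j + 2 by exists (b - 2); arith.
by subst a b; clear; nia.
Qed.

Section Rotated.

Variable c' : seq T.
Hypotheses (lc' : lcyc c') (c'c : c' =i c) (n'n : next c' =1 next c).

Let F i := nth x1 c' i \in S.

Let uc' : uniq c' := lcycle_uniq lc'.
Let sc' : size c' = L := lcycle_size lc'.

Let sum_F : \sum_(0 <= i < L) F i = sg.
Proof.
rewrite -sc' -(count_nat_sum x1 (mem S)) -card_S_count; apply/permP/uniq_perm => //.
Qed.

Let window a b : a <= b -> b <= L -> m.+1 * (\sum_(a <= i < b) F i) <= b - a + m.
Proof.
move=> ab bL; rewrite -{1}[a]add0n big_addn.
apply: (@spaced_sum (fun i => F (i + a))) => i j /andP[ij jb] iF jF.
have ijL : i + a < j + a < L by arith.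
by have [] := gap_index (subxx S) det lc' c'c ijL iF jF; arith.
Qed.

Let S_detour i j : i < L -> j < L -> i != j -> F i -> F j ->
  exists2 k, detour k (nth x1 c' i) (nth x1 c' j) & m <= size k.
Proof. by move=> iL jL ij iF jF; apply: det => //; rewrite nth_uniq ?sc'. Qed.

(* Two neighbours [0] and [l] of [z] in different gaps of [S] would allow two
   longer cycles, through [z] and the component, that skip complementary parts of
   the two gaps. *)
Let two_gaps z s1 s2 l : z \notin c -> z \notin K -> e z (nth x1 c' 0) -> ~~ F 0 ->
  s1 < l < s2 -> s2 < L -> F s1 -> F s2 -> e z (nth x1 c' l) -> ~~ F l ->
  (forall i, i < s1 -> ~~ F i) -> (forall i, s2 < i < L -> ~~ F i) -> False.
Proof.
move=> zc zK z0 F0 /andP[s1l ls2] s2L Fs1 Fs2 zl Fl low high.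
have exJ : exists i, (i < l) && F i by exists s1; rewrite s1l.
have ubJ i : (i < l) && F i -> i <= l by case/andP => /ltnW.
case: (ex_maxnP exJ ubJ) => j /andP[jl Fj] jmax.
have exI : exists i, (l < i) && F i by exists s2; rewrite ls2.
case: (ex_minnP exI) => i /andP[li Fi] imin.
have s1j : s1 <= j by apply: jmax; rewrite s1l.
have is2 : i <= s2 by apply: imin; rewrite ls2.
have s10 : 0 < s1 by rewrite lt0n; apply: contraNneq F0 => <-.
have [jL iL] : j < L /\ i < L by arith.
have zl' : link e [:: z] (nth x1 c' l) (nth x1 c' 0) by rewrite link1 e_sym zl.
have dj k s s' : detour k s s' ->
    forall w, count_mem w c' + count_mem w k + count_mem w [:: z] <= 1.
  move=> dk w; have [uk kK _] := detourP _ _ _ dk.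
  rewrite -addnA -count_cat; apply: disj_outside => //.
    rewrite cat_uniq uk /= orbF andbT; apply: contra zK.
    by move=> zk; apply: kK.
  by move=> u; rewrite mem_cat mem_seq1 c'c => /orP[/(detour_out dk)//|/eqP->].
have js2 : j != s2 by rewrite neq_ltn; apply/orP; left; arith.
have [k dk mk] := S_detour jL s2L js2 Fj Fs2; have [_ _ kl] := detourP _ _ _ dk.
have jls : j < l <= s2 by arith.
have b1 := cross (x0 := x1) e_sym L_max lc' (dj _ _ _ dk) jls s2L kl zl'.
have s1L : s1 < L by arith.
have is1 : i != s1 by rewrite neq_ltn; apply/orP; right; arith.
have [k' dk' mk'] := S_detour iL s1L is1 Fi Fs1; have [_ _ kl'] := detourP _ _ _ dk'.
have h1 : 0 < s1 <= l by arith.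
have h2 : l < i < L by arith.
have b2 := cross_back (x0 := x1) e_sym L_max lc' (dj _ _ _ dk') h1 h2 zl' kl'.
have zero a b : (forall t, a <= t < b -> ~~ F t) -> \sum_(a <= t < b) F t = 0.
  by move=> no; rewrite big_nat big1 // => t /no/negPf->.
(* By the choice of [j] and [i], all of [S] lies in positions [s1] to [j] and [i] to [s2]; two
   windows bound its size. *)
have e1 : \sum_(0 <= t < L) F t = \sum_(s1 <= t < j.+1) F t + \sum_(i <= t < s2.+1) F t.
  rewrite (big_cat_nat (n := s1)) ?(ltnW s1L) //= zero; last first.
    by move=> t /andP[_]; apply: low.
  rewrite add0n (big_cat_nat (n := j.+1)) //=; try arith.
  congr (_ + _); rewrite (big_cat_nat (n := i)) /=; try arith.
  rewrite zero ?add0n; last first.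
    move=> t /andP[jt ti]; apply/negP => Ft; case: (ltngtP t l) => tl.
    - by have := jmax t; rewrite tl Ft => /(_ isT); arith.
    - by have := imin t; rewrite tl Ft => /(_ isT); arith.
    - by move: Fl; rewrite -tl Ft.
  rewrite (big_cat_nat (n := s2.+1)) //=; try arith.
  by rewrite (zero s2.+1) ?addn0 // => t; apply: high.
have sj : s1 <= j.+1 by arith.
have is2' : i <= s2.+1 by arith.
have w1 := window sj jL; have w2 := window is2' s2L; rewrite sum_F in e1.
have : m.+1 * sg <= (j.+1 - s1 + m) + (s2.+1 - i + m) by rewrite e1 mulnDr leq_add.
have := long; have n1 : L + m + #|H'| <= 3 * d + 1 by rewrite -card_T.
have := prod_ge; move: n1 tight b1 b2 mk mk'; rewrite mulSn /=.
by move: (m * sg) (size k) (size k') => p q q'; arith.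
Qed.

(* The neighbours of [z] outside [S] lie in a single gap and are not consecutive. *)
Lemma free_bound_rotated z : z \notin c -> z \notin K -> e z (nth x1 c' 0) ->
  nth x1 c' 0 \notin S -> 2 * #|[set r in c | e z r && (r \notin S)]| + m.+1 * sg <= L + m + 1.
Proof.
move=> zc zK z0 F0; set B := [set r in c | _].
have [s0 s0S] : exists s, s \in S by apply/card_gt0P; apply: ltnW sg_ge2.
have idx s : s \in S -> index s c' < L /\ F (index s c').
  by move=> sS; rewrite -sc' index_mem /F nth_index ?c'c ?Sc.
have exF : exists i, (i < L) && F i.
  by have [iL Fi] := idx s0 s0S; exists (index s0 c'); rewrite iL.
have ubF i : (i < L) && F i -> i <= L by case/andP => /ltnW.
case: (ex_minnP exF) => a /andP[aL Fa] amin.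
case: (ex_maxnP exF ubF) => b /andP[bL Fb] bmax.
have low i : i < a -> ~~ F i.
  by move=> ia; apply/negP => Fi; have := amin i; rewrite Fi (ltn_trans ia aL) => /(_ isT); arith.
have high i : b < i < L -> ~~ F i.
  by move=> /andP[bi iL]; apply/negP => Fi; have := bmax i; rewrite Fi iL => /(_ isT); arith.
have ab : a <= b by apply: amin; rewrite bL.
have w : m.+1 * sg <= b.+1 - a + m.
  rewrite -sum_F (big_cat_nat (n := a)) ?(ltnW aL) //= big_nat big1 ?add0n; last first.
    by move=> i /andP[_ /low/negPf->].
  rewrite (big_cat_nat (n := b.+1)) //=; last by arith.
  rewrite [X in _ * (_ + X)]big_nat [X in _ * (_ + X)]big1 ?addn0; last first.
    by move=> i /high/negPf->.
  by apply: window => //; arith.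
have B_in i : i < L -> nth x1 c' i \in B -> i < a \/ b < i.
  move=> iL; rewrite in_set => /and3P[_ zi iS]; case: (ltngtP i a) => ia; first by left.
    case: (ltngtP i b) => ib; first last.
    - by move: iS; rewrite ib; move: Fb; rewrite /F => ->.
    - by right.
    by case: (@two_gaps z a b i) => //; rewrite ia.
  by move: iS; rewrite ia; move: Fa; rewrite /F => ->.
(* All of [B] lies in the gap around position [0]; the successors of [B] stay in it or reach the
   attachment [a] that ends it. *)
have sub : {subset B :|: next c @: B <= take a.+1 c' ++ drop b.+1 c'}.
  have inT i : i <= a -> nth x1 c' i \in take a.+1 c'.
    by move=> ia; rewrite -(nth_take x1 (n0 := a.+1)) // mem_nth // size_takel ?sc'.
  have inD i : b < i < L -> nth x1 c' i \in drop b.+1 c'.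
    move=> /andP[bi iL]; rewrite -{1}(subnKC bi) -nth_drop mem_nth // size_drop sc'.
    by arith.
  have Bidx v : v \in B -> exists2 i, i < L & nth x1 c' i = v.
    by rewrite in_set => /andP[vc _]; exists (index v c'); rewrite -?sc' ?index_mem ?nth_index ?c'c.
  move=> v; rewrite in_setU mem_cat => /orP[vB|/imsetP[u uB ->]].
    have [i iL iE] := Bidx v vB; move: vB; rewrite -iE => /(B_in i iL)[ia|bi].
      by rewrite inT // ltnW.
    by rewrite inD ?orbT // bi.
  have [i iL iE] := Bidx u uB; rewrite -iE -n'n; move: uB; rewrite -iE => /(B_in i iL)[ia|bi].
    by rewrite next_nth_lt ?sc' ?inT //; arith.
  case: (ltngtP i.+1 L) => iL1; first by rewrite next_nth_lt ?sc' ?inD ?orbT //; arith.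
    by move: iL1; arith.
  have -> : i = (size c').-1 by rewrite sc' -iL1.
  by rewrite next_nth_last ?inT // sc'; arith.
have dis : [disjoint B & next c @: B].
  apply/pred0P => v; apply/negP => /andP[/=]; rewrite in_set => /and3P[_ zv _] /imsetP[u].
  rewrite in_set => /and3P[uc2 zu _] vE.
  by have := next_nonadj e_sym L_max lc zc uc2 zu; rewrite -vE zv.
have : #|B :|: next c @: B| <= a.+1 + (L - b.+1).
  have -> : a.+1 + (L - b.+1) = size (take a.+1 c' ++ drop b.+1 c').
    by rewrite size_cat size_takel ?sc' // size_drop sc'.
  by apply: leq_trans (card_size _); apply/subset_leq_card/subsetP.
rewrite cardsU (disjoint_setI0 dis) cards0 subn0 card_imset; last exact: lcycle_inj lc.
by move: w; move: (m.+1 * sg) #|B| => p q; arith.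
Qed.

End Rotated.

Lemma free_bound z : z \notin c -> z \notin K ->
  2 * #|[set r in c | e z r && (r \notin S)]| + m.+1 * sg <= L + m + 1.
Proof.
move=> zc zK; set B := [set r in c | _].
case: (set_0Vmem B) => [->|[r]].
  by rewrite cards0 muln0 add0n -addnA (leq_trans long) ?leq_addr.
rewrite in_set => /and3P[rc zr rS].
have [c' [lc' c'c n'n c'0]] := rotate_first x1 lc rc.
by apply: (free_bound_rotated lc' c'c n'n zc zK); rewrite c'0.
Qed.

Let free_degree z : z \notin c -> z \notin K ->
  d <= #|[set r in c | e z r && (r \notin S)]| + #|N z :&: S| + #|N z :&: H'|.
Proof.
move=> zc zK; apply: leq_trans (deg_ge z) _.
set B := [set r in c | _]; apply: leq_trans (_ : #|B :|: (N z :&: S) :|: (N z :&: H')| <= _).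
  apply/subset_leq_card/subsetP => y; rewrite in_set => zy.
  rewrite !in_setU !in_setI ![y \in N z]in_set zy /= in_set zy /=.
  case yc : (y \in c) => /=; first by case: (y \in S).
  rewrite [y \in H']in_set yc /= (_ : y \in K = false) ?orbT //.
  by apply/negbTE; apply: contra zK => yK; apply: Kclosed yK zc _; rewrite e_sym.
by rewrite (leq_trans (leq_card_setU _ _)) // leq_add2r leq_card_setU.
Qed.

(** Every attachment is adjacent to all of [K], so one adjacent to all of [H'] suffices. By
    [free_bound] the at most two vertices of [H'] have few neighbours on the cycle outside [S], so
    their degrees force a common one in [S]. *)
Lemma tight_conclusion : exists2 v, v \in c & forall x, x \notin c -> e v x.
Proof.
suff [v vS vH] : exists2 v, v \in S & forall z, z \in H' -> e v z.
  exists v; first exact: Sc.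
  move=> x xc; case: (boolP (x \in K)) => xK; last by apply: vH; rewrite in_set xc.
  rewrite e_sym; apply: join; rewrite ?in_setU ?vS ?orbT //.
  by apply: contraTneq vS => <-; apply: KS_disjoint.
have inH z : z \in H' -> z \notin c /\ z \notin K by rewrite in_set => /andP.
have hle : #|H'| <= 2 by move: budget prod_ge; move: (m * sg) => p; arith.
have n1 : L + m + #|H'| <= 3 * d + 1 by rewrite -card_T.
have K2 : 2 <= m := K_ge2.
have s2 := sg_ge2.
case: (ltngtP #|H'| 1) => hH.
- have [v vS] : exists v, v \in S by apply/card_gt0P; apply: ltnW s2.
  exists v => // z; rewrite (cards0_eq (_ : #|H'| = 0)) ?in_set0 //.
  by move: hH; arith.
- have c2 : #|H'| == 2 by rewrite eqn_leq hle hH.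
  have [z1 [z2 [z12 HE]]] := elimT (cards2P _) c2.
  have z1H : z1 \in H' by rewrite HE in_set2 eqxx.
  have z2H : z2 \in H' by rewrite HE in_set2 eqxx orbT.
  have [z1c z1K] := inH _ z1H; have [z2c z2K] := inH _ z2H.
  have b1 := free_bound z1c z1K; have b2 := free_bound z2c z2K.
  have f1 := free_degree z1c z1K; have f2 := free_degree z2c z2K.
  have h1 : #|N z1 :&: H'| = e z1 z2.
    have -> : N z1 :&: H' = if e z1 z2 then [set z2] else set0.
      apply/setP => w; rewrite HE in_setI in_set in_set2.
      case: (eqVneq w z1) => [->|_] /=; first by rewrite e_irr; case: ifP;
        rewrite ?in_set1 ?(negPf z12) ?in_set0.
      by case: (eqVneq w z2) => [->|w2]; case: (e z1 z2);
        rewrite ?in_set1 ?in_set0 ?eqxx ?(negPf w2) ?andbF.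
    by case: (e z1 z2); rewrite ?cards1 ?cards0.
  have h2 : #|N z2 :&: H'| = e z1 z2.
    have -> : N z2 :&: H' = if e z1 z2 then [set z1] else set0.
      apply/setP => w; rewrite HE in_setI in_set in_set2 (e_sym z1).
      case: (eqVneq w z2) => [->|_] /=; first by rewrite e_irr; case: ifP;
        rewrite ?in_set1 1?eq_sym ?(negPf z12) ?in_set0.
      by case: (eqVneq w z1) => [->|w2]; case: (e z2 z1);
        rewrite ?in_set1 ?in_set0 ?eqxx ?(negPf w2) ?andbF.
    by case: (e z1 z2); rewrite ?cards1 ?cards0.
  rewrite h1 in f1; rewrite h2 in f2.
  suff /pred0Pn[v /andP[/=]] : ~~ [disjoint N z1 :&: S & N z2 :&: S].
    rewrite !in_setI ![v \in N _]in_set => /andP[v1 vS] /andP[v2 _]; exists v => // z.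
    by rewrite HE in_set2 => /orP[]/eqP->; rewrite e_sym.
  apply/negP => dis.
  have kk : #|N z1 :&: S| + #|N z2 :&: S| <= sg.
    rewrite -cardsUI (disjoint_setI0 dis) cards0 addn0 subset_leq_card //.
    by rewrite subUset !subsetIr.
  have hh : #|H'| = 2 by apply/eqP.
  (* If the two vertices are adjacent, they form a component, and minimality of [K] gives
     [m = 2]. *)
  rewrite hh in n1; case ez: (e z1 z2) in f1 f2.
    have mle : m <= 2.
      rewrite -hh; apply: leq_trans (component_min z1c z2c ez) _.
      apply/subset_leq_card/subsetP => w wz; have wc := component_outside z1c wz.
      rewrite [w \in H']in_set wc; apply: contra z1K => wK.
      rewrite in_set (sym_connect_sym (outside_edge_sym e_sym c)) in wz.
      by rewrite in_set in wK; rewrite in_set; apply: connect_trans wK wz.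
    have m2 : m = 2 by apply/eqP; rewrite eqn_leq mle.
    move: b1 b2 f1 f2 kk n1 tight d_ge4; rewrite m2.
    move: #|N z1 :&: S| #|N z2 :&: S| #|[set r in c | e z1 r && _]|
      #|[set r in c | e z2 r && _]| => p q r t; arith.
  move: b1 b2 f1 f2 kk n1 tight d_ge4 prod_ge; rewrite mulSn.
  move: (m * sg) #|N z1 :&: S| #|N z2 :&: S| #|[set r in c | e z1 r && _]|
    #|[set r in c | e z2 r && _]| => pr p q r t; arith.
have /cards1P[z HE] : #|H'| == 1 by rewrite hH.
have zH : z \in H' by rewrite HE in_set1.
have [zc zK] := inH _ zH; have b := free_bound zc zK; have f := free_degree zc zK.
have h0 : #|N z :&: H'| = 0.
  apply/eqP; rewrite cards_eq0; apply/eqP/setP => w; rewrite HE in_setI in_set in_set1 in_set0.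
  by apply/negP => /andP[zw /eqP wE]; rewrite wE e_irr in zw.
have : 0 < #|N z :&: S|.
  move: b f n1 tight prod_ge; rewrite h0 mulSn hH.
  by move: (m * sg) #|N z :&: S| #|[set r in c | _]| => p q r; arith.
case/card_gt0P => v; rewrite in_setI in_set => /andP[zv vS]; exists v => // w.
by rewrite HE in_set1 => /eqP->; rewrite e_sym.
Qed.

End Tight.

Lemma nondominating_center : exists2 v, v \in c & forall x, x \notin c -> e v x.
Proof.
case: (leqP (m + sg) (d + 2)) => e2.
  by have [tight long] := tight_of_excess_le1 e2; apply: tight_conclusion.
have e3 : m + sg = d + 3 by have := KS_le; arith.
case: (ltngtP m 2) => m2; first by have := K_ge2; arith.
  by case: (excess2_absurd e3 m2).
exact: center_of_excess2 e3 m2.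
Qed.

End NonDominating.

(** * Assembly of the two cases *)

Theorem corollary1p4 (n : nat) (T : finType) (e : rel T)
    (n_ge13 : 13 <= n)
    (e_simple : simple_graph e)
    (card_T : #|T| = n)
    (e_2connected : k_connected 2 e)
    (e_min_degree :
      ((n%:R - 1) / 3%:R <= (min_degree e)%:R :> rat)%R) :
  has_spanning_jellyfish e.
Proof.
have [e_sym e_irr] := e_simple; have [_ conn2] := e_2connected.
have {e_min_degree} n_le := rat_degree_bound e_min_degree.
set d := min_degree e in n_le.
(* This is where [13 <= n] enters: [d <= 3] would give [n <= 10]. *)
have d4 : 4 <= d.
  have := leq_trans n_ge13 n_le; apply: contraLR; rewrite -!leqNgt => d3.
  by rewrite addn1 ltnS (@leq_trans (3 * 3)) // leq_mul2l.
have deg x : d <= #|[set y | e x y]| by rewrite cardsE; apply: min_degree_le.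
rewrite -card_T in n_ge13 n_le.
have [x _] : exists x : T, x \in T by apply/card_gt0P; apply: leq_trans n_ge13.
have [y [z []]] : exists y z, [/\ y \in [set w | e x w], z \in [set w | e x w] & y != z].
  by apply/card_gt1P; apply: leq_trans (deg x); apply: leq_trans d4.
rewrite !inE => xy xz yz.
have [c0 [uc0 ec0 c03]] : exists c, [/\ uniq c, cycle e c & 3 <= size c].
  have ne w : e x w -> x != w by apply: contraTneq => ->; rewrite e_irr.
  apply: (exists_cycle e_sym yz xy xz (ne y xy) (ne z xz)).
  by apply: conn2; rewrite cards1.
have [c1 [uc1 ec1 c01 L_max]] := exists_longest_cycle uc0 ec0.
have lc1 : lcycle e (size c1) c1 by rewrite /lcycle uc1 ec1 eqxx.
have L3 := leq_trans c03 c01; move: (size c1) lc1 L_max L3 => L lc1 L_max L3 {c01}.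
have jelly c v : lcycle e L c -> v \in c -> (forall w, w \notin c -> e v w) ->
    has_spanning_jellyfish e.
  by case/and3P => uc ec /eqP sc; apply: jellyfish_of_cycle; rewrite ?sc.
have [/existsP[c /andP[lc /existsP[x1 /existsP[y1 /and3P[x1c y1c xy1]]]]]|indep] :=
    boolP [exists c : L.-tuple T, lcycle e L c &&
      [exists u, exists v, [&& u \notin c, v \notin c & e u v]]].
  (* Among the outside vertices with an outside neighbour, one with a smallest component is
     chosen. *)
  pose P u := (u \notin c) && [exists v, (v \notin c) && e u v].
  have Px1 : P x1.
    by rewrite /P x1c; apply/existsP; exists y1; rewrite y1c.
  case: (@arg_minnP _ x1 P (fun u => #|component e c u|) Px1).
  move=> x2 /andP[x2c /existsP[y2 /andP[y2c xy2]]] min.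
  have min' u v : u \notin c -> v \notin c -> e u v ->
      #|component e c x2| <= #|component e c u|.
    by move=> uc vc uv; apply: min; rewrite /P uc; apply/existsP; exists v; rewrite vc.
  have [v vc vN] := nondominating_center e_sym e_irr L_max L3 d4 deg n_le conn2
    lc min' x2c y2c xy2.
  exact: jelly lc vc vN.
have [/existsP[c /andP[lc /existsP[v /andP[vc /forall_inP vN]]]]|no_jelly] :=
    boolP [exists c : L.-tuple T, lcycle e L c &&
      [exists v, (v \in c) && [forall u in [pred u | u \notin c], e v u]]].
  exact: jelly lc vc vN.
have of_size c : lcycle e L c -> exists t : L.-tuple T, tval t = c.
  by case/and3P => _ _ sc; exists (Tuple sc).
case: (@dominating_absurd T e L d e_sym e_irr L_max L3 (ltnW (ltnW d4)) deg n_le _ _ c1 lc1).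
  move=> c lc u v uc vc; apply: contra indep => uv; have [t tc] := of_size c lc.
  apply/existsP; exists t; rewrite tc lc; apply/existsP; exists u; apply/existsP; exists v.
  by rewrite -tc in uc vc; apply/and3P.
move=> c lc v vc; apply/exists_inP; apply: contraR no_jelly => none.
have [t tc] := of_size c lc; apply/existsP; exists t; rewrite tc lc.
rewrite -tc in vc none; apply/existsP; exists v; apply/andP; split=> //.
apply/forall_inP => u uc.
by apply: contraR none => nvu; apply/exists_inP; exists u.
Qed.
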